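(* Let $f=f(u,v,s)$ be the normal form of a deformation of an $S_1^\pm$ singularity with $c_2(0)=c_{20}^2>0$, and let $a_{20}(\tilde s),a_{11}(\tilde s),a_{02}(\tilde s)$ be the invariants of the Whitney umbrella of $f(\cdot,\cdot,-\tilde s^2)$ at $(u(\tilde s),0)$, $\tilde s\ne0$ (all notation as defined in the context). Then these functions can be expanded as follows: $$a_{20}(\tilde s)=\frac{1}{\tilde s^2}\left(\frac{f_{31}(0)^2}{2c_{20}^2}-\frac{f_{31}(0)\bigl(f_{31}(0)c_3(0)-c_{20}^2(3(f_{31})_u(0)-d_1(0,0,0)f_{21}(0))\bigr)}{c_{20}^5}\tilde s+O_{\tilde s}(2)\right),$$ $$a_{11}(\tilde s)=\frac{1}{\tilde s^2}\left(\frac{f_{31}(0)}{2c_{20}^2}-\frac{2c_3(0)f_{31}(0)-c_{20}^2(3(f_{31})_u(0)-d_1(0,0,0)f_{21}(0))}{2c_{20}^5}\tilde s+O_{\tilde s}(2)\right),$$ $$a_{02}(\tilde s)=\frac{1}{\tilde s^2}\left(\frac{1}{2c_{20}^2}+O_{\tilde s}(1)\right).$$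
   Context: All maps and germs are $C^\infty$. The normal form of a deformation of an $S_1^\pm$ singularity is the germ $f:(\mathbb{R}^2\times\mathbb{R},0)\to(\mathbb{R}^3,0)$, $$f(u,v,s)=\bigl(u,\ u^2f_{21}(u)+v^2+us f_{24}(u,s),\ u^2f_{31}(u)+v^2f_{32}(u,v,s)+vf_{33}(u,s)+usf_{34}(u,s)\bigr),$$ with smooth function-germs $f_{ij}$ satisfying $f_{32}(0,0,0)=f_{33}(0,0)=(f_{33})_u(0,0)=0$, $f_{33}(0,s)=s$, and $(f_{32})_v(0,0,0)(f_{33})_{uu}(0,0)\neq0$ (positive for $S_1^+$, negative for $S_1^-$; here an $S_1^\pm$ singularity is a germ $\mathcal{A}$-equivalent, i.e. equivalent under diffeomorphism-germs of source and target, to $(u,v)\mapsto(u,v^2,v(u^2\pm v^2))$). Write $$f_{33}(u,s)=s+us\,c_1(s)+u^2c_2(s)+u^3c_3(s)+u^4c_4(u,s),$$ $$f_{32}(u,v,s)=u\,d_1(u,v,s)+v\,d_2(u,v,s)+s\,d_3(u,v,s)$$ with smooth $c_i,d_i$, and assume $c_2(0)>0$, $c_2(0)=c_{20}^2$ with $c_{20}>0$. Put $s=-\tilde s^2$. The singular points of $f(\cdot,\cdot,s)$ are $\{v=0,\ f_{33}(u,s)=0\}$. Let $u(\tilde s)$ be the smooth function-germ with $u(0)=0$, $u'(0)=1/c_{20}>0$ and $f_{33}(u(\tilde s),-\tilde s^2)=0$; the singular points of $f(\cdot,\cdot,-\tilde s^2)$ near the origin are $(u(\pm\tilde s),0)$,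 and for small $\tilde s\ne0$ they are Whitney umbrellas (germs $\mathcal{A}$-equivalent to $(u,v)\mapsto(u,uv,v^2)$ at the origin). Invariants of a Whitney umbrella $h$ at $p$: up to a diffeomorphism of the source and an orientation-preserving isometry of the target it has the form $\bigl(u,\,uv+O(3),\,\tfrac12(a_{20}u^2+2a_{11}uv+a_{02}v^2)+O(3)\bigr)$. For a coordinate system $(u,v)$ with $\operatorname{Ker}dh_p=\langle\partial_v\rangle$ and $|h_u,h_{uv},h_{vv}|>0$ at $p$ (where $|\cdot,\cdot,\cdot|=\det$; replace $v$ by $-v$ if necessary), the invariants are $$a_{20}=\tfrac14A^{-3/2}B^{1/2}C^{-2}D,\quad a_{11}=\tfrac12A^{-1/2}C^{-2}E,\quad a_{02}=A^{1/2}B^{3/2}C^{-2}\quad\text{at }p,$$ where $A=h_u\cdot h_u$, $B=|h_u\times h_{vv}|^2$, $C=|h_u,h_{uv},h_{vv}|$, $D=|h_u,h_{uu},h_{vv}|^2+4|h_u,h_{uv},h_{vv}||h_u,h_{uv},h_{uu}|$, and $$E=2|h_u,h_{uv},h_{vv}|\bigl((h_u\cdot h_u)(h_{vv}\cdot h_{uv})-(h_u\cdot h_{uv})(h_{vv}\cdot h_u)\bigr)-|h_u\times h_{vv}|^2|h_u,h_{uu},h_{vv}|.$$ The functions $a_{20}(\tilde s),a_{11}(\tilde s),a_{02}(\tilde s)$ are these invariants for $h=f(\cdot,\cdot,-\tilde s^2)$ at $p=(u(\tilde s),0)$. $O_{\tilde s}(n)$ denotes terms of degree at least $n$ in $\tilde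 s$ (smooth functions of $\tilde s$ divisible by $\tilde s^n$). *)

(* Defs.v *)
From HB Require Import structures.
From mathcomp Require Import all_boot all_order all_algebra.
From mathcomp Require Import all_classical all_reals all_analysis.

Set Implicit Arguments.
Unset Strict Implicit.
Unset Printing Implicit Defensive.

Import Order.TTheory GRing.Theory Num.Theory.
Import numFieldNormedType.Exports.

Local Open Scope classical_set_scope.
Local Open Scope ring_scope.

(* For finite-dimensional V (R, R^2 and R^3 below) the continuity of all the
   directional derivatives of order <= k on the open set U is the usual C^k. *)
Fixpoint Ck (R : realType) (V W : normedModType R) (k : nat) (U : set V)
    (f : V -> W) : Prop :=
  match k with
  | 0 => forall x, U x -> {for x, continuous f}
  | k'.+1 => (forall x, U x -> differentiable f x) /\
             (forall v : V, Ck k' U ('D_v f))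
  end.

(* A C^oo germ at 0 is represented by a total function, of which only the
   values near 0 matter. *)
Definition smooth_germ (R : realType) (V W : normedModType R) (f : V -> W) :
    Prop :=
  exists2 U : set V, open_nbhs 0 U & forall k, Ck k U f.

(* g = O_t(n): a smooth germ in one variable t, divisible by t^n. *)
Definition Osmooth (R : realType) (n : nat) (g : R -> R) : Prop :=
  exists2 r : R -> R, smooth_germ r & \forall t \near (0 : R), g t = t ^+ n * r t.

Section Euclidean3.
Variable R : realType.
Implicit Types a b c : 'rV[R]_3.

Definition vec3 (x y z : R) : 'rV[R]_3 := \row_j [:: x; y; z]`_j.

Definition dot3 a b : R := \sum_j a 0 j * b 0 j.

Definition cross3 a b : 'rV[R]_3 :=
  let a1 := a 0 0 in let a2 := a 0 1 in let a3 := a 0 2%:R in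
  let b1 := b 0 0 in let b2 := b 0 1 in let b3 := b 0 2%:R in
  vec3 (a2 * b3 - a3 * b2) (a3 * b1 - a1 * b3) (a1 * b2 - a2 * b1).

Definition det3 a b c : R := \det (\matrix_(i, j) [:: a; b; c]`_i 0 j).

End Euclidean3.

Section Partial2.
Variables (R : realType) (W : normedModType R).
Implicit Types h : R * R -> W.

Definition pd1 h : R * R -> W := 'D_((1, 0) : R * R) h.
Definition pd2 h : R * R -> W := 'D_((0, 1) : R * R) h.

End Partial2.

Section WhitneyUmbrella.
Variable R : realType.
Implicit Types (h : R * R -> 'rV[R]_3) (p : R * R).

Definition WA h p : R := dot3 (pd1 h p) (pd1 h p).

Definition WB h p : R :=
  let n := cross3 (pd1 h p) (pd2 (pd2 h) p) in dot3 n n.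

Definition WC h p : R := det3 (pd1 h p) (pd2 (pd1 h) p) (pd2 (pd2 h) p).

Definition WD h p : R :=
  let hu := pd1 h p in
  let huu := pd1 (pd1 h) p in
  let huv := pd2 (pd1 h) p in
  let hvv := pd2 (pd2 h) p in
  det3 hu huu hvv ^+ 2 + 4 * det3 hu huv hvv * det3 hu huv huu.

Definition WE h p : R :=
  let hu := pd1 h p in
  let huu := pd1 (pd1 h) p in
  let huv := pd2 (pd1 h) p in
  let hvv := pd2 (pd2 h) p in
  let n := cross3 hu hvv in
  2 * det3 hu huv hvv *
    (dot3 hu hu * dot3 hvv huv - dot3 hu huv * dot3 hvv hu)
  - dot3 n n * det3 hu huu hvv.

(* The pair (h, p) in coordinates where |h_u, h_uv, h_vv| > 0 at p, v being
   replaced by -v if necessary.  The u-axis keeps its direction: replacing u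
   by -u preserves the sign of this determinant but changes that of a_11. *)
Definition adapted h p : (R * R -> 'rV[R]_3) * (R * R) :=
  if 0 < WC h p then (h, p)
  else (fun q => h (q.1, - q.2), (p.1, - p.2)).

(* The invariants of the Whitney umbrella h at p, where (u, v) is a coordinate
   system with Ker dh_p = <d/dv>. *)
Definition whitney_a20 h p : R :=
  let: (g, q) := adapted h p in
  1 / 4 * WA g q `^ (- (3 / 2)) * WB g q `^ (1 / 2) * WC g q ^- 2 * WD g q.

Definition whitney_a11 h p : R :=
  let: (g, q) := adapted h p in
  1 / 2 * WA g q `^ (- (1 / 2)) * WC g q ^- 2 * WE g q.

Definition whitney_a02 h p : R :=
  let: (g, q) := adapted h p in
  WA g q `^ (1 / 2) * WB g q `^ (3 / 2) * WC g q ^- 2.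

End WhitneyUmbrella.

Section S1Deformation.
Variable R : realType.
Variables (f21 f31 : R -> R) (f24 f33 f34 : R * R -> R) (f32 : R * R * R -> R).

Definition S1_deformation (x : R * R * R) : 'rV[R]_3 :=
  let: (u, v, s) := x in
  vec3 u
    (u ^+ 2 * f21 u + v ^+ 2 + u * s * f24 (u, s))
    (u ^+ 2 * f31 u + v ^+ 2 * f32 (u, v, s) + v * f33 (u, s)
       + u * s * f34 (u, s)).

(* In S1_nondegenerate the sign of the product distinguishes S_1^+ (positive)
   from S_1^- (negative); both cases are allowed. *)
Record S1_normal_form : Prop := {
  S1_smooth21 : smooth_germ f21;
  S1_smooth24 : smooth_germ f24;
  S1_smooth31 : smooth_germ f31;
  S1_smooth32 : smooth_germ f32;
  S1_smooth33 : smooth_germ f33;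
  S1_smooth34 : smooth_germ f34;
  S1_f32_0 : f32 (0, 0, 0) = 0;
  S1_f33_0 : f33 (0, 0) = 0;
  S1_f33_u : pd1 f33 (0, 0) = 0;
  S1_f33_s : \forall s \near (0 : R), f33 (0, s) = s;
  S1_nondegenerate :
    'D_((0, 1, 0) : R * R * R) f32 (0, 0, 0) * pd1 (pd1 f33) (0, 0) != 0
}.

End S1Deformation.

(* Main.v *)
Require Import Defs.
From HB Require Import structures.
From mathcomp Require Import all_boot all_order all_algebra.
From mathcomp Require Import all_classical all_reals all_analysis.
From mathcomp Require Import ring lra.

Set Implicit Arguments.
Unset Strict Implicit.
Unset Printing Implicit Defensive.

Import Order.TTheory GRing.Theory Num.Theory.
Import numFieldNormedType.Exports.

Local Open Scope classical_set_scope.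
Local Open Scope ring_scope.

(* At (u, 0) with f33 (u, s) = 0 the derivatives of f(., ., s) are
   h_u = (1, p, q), h_uu = (0, P, Q), h_uv = (0, 0, w) and h_vv = (0, 2, m), and
   the invariants depend on w only through w^2, so that replacing v by -v does
   not matter.  Along u = us t, s = - t^2 all these are smooth functions of t,
   with p, q, m = O(t) and w = t W, where W 0 = 2 c20.  Hence t^2 a_20, t^2 a_11
   and t^2 a_02 extend to smooth germs, and by Hadamard's lemma only their
   1-jets at 0 remain to be computed; the 1-jet of W comes from dividing
   f33 (us t, - t^2) = 0 by t^2 and differentiating. *)

(** * C^k functions *)

(** Few terms survive in the 1-jets. Since p, q, m = O(t), A = 1 + O(t^2) and B = 4 + O(t^2), so
    their real powers contribute constants only, and the terms of D and E that contain w^2 start at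
    order 2. What remains is W and the determinant N = |h_u, h_uu, h_vv| = P m - 2 Q, with N(0) = -4
    f31(0) and N'(0) = -4 K / c20; this is the origin of the combination [K]. The slope of W
    involves c1(0) and u''(0), both absent from the result; the relation at the singular point
    removes them together and leaves 2 c3(0) / c20^2.

    The remainders must be smooth germs, not merely small, so smoothness has to survive composition
    and division by t. Two closure properties carry the inductions on the order: the chain rule in
    coordinates gives sums of products of scalar functions of the same kind, and the means of y^j
    g(t y) over [0, 1] are stable under differentiation, (j, g) becoming (j + 1, g'). The second one
    yields Hadamard's lemma from the mean value theorem, without differentiating under an integral
    sign. *)

Section CkCalculus.
Variable R : realType.
Implicit Types V W : normedModType R.

(** The difference [k = g - f] vanishes near [x], hence is o(id) with zero linear part;
    [diff_unique] identifies its differential, and [g = f + k]. *)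
Lemma near_eq_differentiable V W (f g : V -> W) (x : V) :
  {near x, f =1 g} -> differentiable f x -> differentiable g x.
Proof.
move=> fg df; pose k := g - f.
have k0 : \forall y \near x, k y = 0.
  by near=> y; rewrite /k fctE; apply/eqP; rewrite subr_eq0 eq_sym; apply/eqP; near: y.
have kx : k x = 0 by exact: nbhs_singleton k0.
have ko : k \o shift x = cst (k x) + (\0 : {linear V -> W}) +o_ 0 id.
  apply/eqaddoP => _/posnumP[e] /=.
  have : \forall h \near (0 : V), k (h + x) = 0.
    move: k0; rewrite (near_shift 0 x) subr0.
    by apply: filterS => h.
  apply: filterS => h /= kh.
  by rewrite [X in `|X|](_ : _ = k (h + x) - (k x + 0)) // kh kx addr0 subr0 normr0 mulr_ge0.
have c0 : continuous (\0 : {linear V -> W}) by exact: cst_continuous.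
have dk0 := diff_unique c0 ko.
have dk : differentiable k x.
  by apply/diff_locallyP; rewrite dk0; split; [exact: c0|exact: ko].
have -> : g = f + k by apply/funext => y; rewrite /k !fctE addrC subrK.
exact: differentiableD.
Unshelve. all: by end_near. Qed.

Lemma near_open V (U : set V) (P : V -> Prop) x :
  open U -> U x -> (forall y, U y -> P y) -> \forall y \near x, P y.
Proof. by move=> oU Ux UP; apply: filterS (open_nbhs_nbhs (conj oU Ux)). Qed.

Lemma Ck_sub V W k (U U' : set V) (f : V -> W) :
  U' `<=` U -> Ck k U f -> Ck k U' f.
Proof.
move=> U'U; elim: k f => [|k IH] f /=; first by move=> cf x /U'U /cf.
by move=> [df Df]; split=> [x /U'U /df //|v]; exact: IH.
Qed.

(** Rules such as Leibniz's are available only on [U], the functions being arbitrary outside.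
    Openness of [U] turns agreement on [U] into agreement of all directional derivatives there. *)
Lemma eq_Ck V W k (U : set V) (f g : V -> W) :
  open U -> (forall x, U x -> f x = g x) -> Ck k U f -> Ck k U g.
Proof.
move=> oU; elim: k f g => [|k IH] f g fg /=.
  move=> cf x Ux; rewrite /prop_for /continuous_at -(fg x Ux).
  apply: cvg_trans (cf x Ux); apply: near_eq_cvg.
  by apply: near_open Ux _ => // y Uy; rewrite fg.
move=> [df Df]; split=> [x Ux|v].
  by apply: near_eq_differentiable (df x Ux); exact: near_open Ux fg.
apply: IH (Df v) => x Ux; apply: near_eq_derive.
exact: near_open Ux fg.
Qed.

Lemma CkW V W k (U : set V) (f : V -> W) : Ck k.+1 U f -> Ck k U f.
Proof.
elim: k f => [|k IH] f /=.
  by move=> [df _] x Ux; exact/differentiable_continuous/df.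
by move=> [df Df]; split=> // v; apply: IH; exact: Df.
Qed.

Lemma Ck_cst V W k (U : set V) (a : W) : Ck k U (cst a : V -> W).
Proof.
elim: k a => [|k IH] a /=; first by move=> x _; exact: cst_continuous.
split=> [x _|v]; first exact: differentiable_cst.
suff -> : 'D_v (cst a : V -> W) = cst 0 by exact: IH.
by apply/funext => x; rewrite derive_cst.
Qed.

Lemma CkD V W k (U : set V) (f g : V -> W) : open U ->
  Ck k U f -> Ck k U g -> Ck k U (f + g).
Proof.
move=> oU; elim: k f g => [|k IH] f g /=.
  by move=> cf cg x Ux; apply: continuousD; [exact: cf|exact: cg].
move=> [df Df] [dg Dg]; split=> [x Ux|v].
  by apply: differentiableD; [exact: df|exact: dg].
apply: eq_Ck (IH _ _ (Df v) (Dg v)) => // x Ux.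
by rewrite deriveD //; apply: diff_derivable; [exact: df|exact: dg].
Qed.

Lemma CkM V k (U : set V) (f g : V -> R) : open U ->
  Ck k U f -> Ck k U g -> Ck k U (f * g).
Proof.
move=> oU; elim: k f g => [|k IH] f g.
  by move=> cf cg x Ux; apply: continuousM; [exact: cf|exact: cg].
move=> Cf Cg; have [df Df] := Cf; have [dg Dg] := Cg; split=> [x Ux|v].
  by apply: differentiableM; [exact: df|exact: dg].
have := CkD oU (IH _ _ (CkW Cf) (Dg v)) (IH _ _ (CkW Cg) (Df v)).
apply: eq_Ck => // x Ux.
by rewrite deriveM //; apply: diff_derivable; [exact: df|exact: dg].
Qed.

Lemma Ck_sum V k (U : set V) n (f : 'I_n -> V -> R) : open U ->
  (forall i, Ck k U (f i)) -> Ck k U (\sum_(i < n) f i).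
Proof.
move=> oU Cf; elim/big_ind: _ => [|g h|i _]; last exact: Cf.
- exact: Ck_cst.
- exact: CkD.
Qed.

Section Composition.
Variables (V W : normedModType R) (n : nat) (e : 'I_n -> V).
Implicit Types (g : 'I_n -> W -> R) (f : V -> R).

(** A map into [V] given by scalar coordinates along fixed vectors [e i]. The chain rule then
    involves only scalar products of derivatives, never an operator-valued differential. *)
Definition lincomb g (x : W) : V := \sum_(i < n) g i x *: e i.

Lemma lincombE g : lincomb g = \sum_(i < n) (fun x => g i x *: e i).
Proof. by apply/funext => x; rewrite fct_sumE. Qed.

Lemma differentiable_lincomb g x :
  (forall i, differentiable (g i) x) -> differentiable (lincomb g) x.
Proof.
move=> dg; rewrite lincombE; apply: differentiable_sum => i.
exact: differentiableZl.
Qed.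

Lemma continuous_lincomb g x :
  (forall i, {for x, continuous (g i)}) -> {for x, continuous (lincomb g)}.
Proof.
move=> cg; rewrite lincombE; elim/big_ind: _ => [|g1 g2 c1 c2|i _].
- exact: cst_continuous.
- exact: continuousD.
- by apply: continuousZr_tmp; exact: cg.
Qed.

Lemma derive_lincomb g x w : (forall i, differentiable (g i) x) ->
  'D_w (lincomb g) x = \sum_(i < n) 'D_w (g i) x *: e i.
Proof.
move=> dg; rewrite lincombE derive_sum => [|i]; last first.
  by apply: diff_derivable; exact: differentiableZl.
apply: eq_bigr => i _; rewrite deriveE; last exact: differentiableZl.
by rewrite diffZl // deriveE.
Qed.

Lemma derive_comp_lincomb f g x w :
  (forall i, differentiable (g i) x) -> differentiable f (lincomb g x) ->
  'D_w (f \o lincomb g) x = \sum_(i < n) 'D_w (g i) x * 'D_(e i) f (lincomb g x).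
Proof.
move=> dg df; have dl := differentiable_lincomb dg.
rewrite deriveE; last exact: differentiable_comp.
rewrite diff_comp //= -(deriveE w dl) derive_lincomb // linear_sum.
by apply: eq_bigr => i _; rewrite linearZ (deriveE (e i) df).
Qed.

(** Each summand of the chain rule is a coordinate derivative times ['D_(e i) f] composed with the
    same inner map. The second factor is again a composite of the kind treated, one order lower, so
    the induction runs over all [f]. *)
Lemma Ck_comp k (U : set W) (O : set V) f g : open U -> open O ->
  (forall i, Ck k U (g i)) -> Ck k O f -> (forall x, U x -> O (lincomb g x)) ->
  Ck k U (f \o lincomb g).
Proof.
move=> oU oO; elim: k f g => [|k IH] f g Cg Cf UO.
  move=> x Ux; apply: continuous_comp; last exact/Cf/UO.
  by apply: continuous_lincomb => i; exact: Cg.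
have [df Df] := Cf; have dg x i : U x -> differentiable (g i) x.
  by move=> Ux; exact: (Cg i).1.
split=> [x Ux|w].
  apply: differentiable_comp; last exact/df/UO.
  by apply: differentiable_lincomb => i; exact: dg.
apply: (@eq_Ck _ _ _ _ (\sum_(i < n) ('D_w (g i) * ('D_(e i) f \o lincomb g)))) => //.
  move=> x Ux; rewrite derive_comp_lincomb ?fct_sumE // => [i|].
    exact: dg.
  exact/df/UO.
apply: Ck_sum => // i; apply: CkM => //; first exact: (Cg i).2.
by apply: IH => // [j|]; [exact: CkW|exact: Df].
Qed.

End Composition.
End CkCalculus.
(** * Hadamard's lemma *)

Section ScalarDerive.
Variables (R : realType) (V : normedModType R).
Implicit Types (f g : V -> R) (x v : V).

Lemma is_derive_add f g x v a b : is_derive x v f a -> is_derive x v g b ->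
  is_derive x v (fun y => f y + g y) (a + b).
Proof. exact: is_deriveD. Qed.

Lemma is_derive_mul f g x v a b : is_derive x v f a -> is_derive x v g b ->
  is_derive x v (fun y => f y * g y) (f x * b + g x * a).
Proof. exact: is_deriveM. Qed.

Lemma is_derive_scale f x v (c a : R) : is_derive x v f a ->
  is_derive x v (fun y => c * f y) (c * a).
Proof.
by move=> Df; have := is_derive_mul (is_derive_cst c x v) Df; rewrite mulr0 addr0.
Qed.

Lemma is_derive_exp f x v n a : is_derive x v f a ->
  is_derive x v (fun y => f y ^+ n) (n%:R * f x ^+ n.-1 * a).
Proof.
move=> Df; have -> : (fun y => f y ^+ n) = f ^+ n.
  by apply/funext => y; rewrite !fctE.
exact: is_deriveX.
Qed.

Lemma is_derive_inv f x v (a : R) : f x != 0 -> is_derive x v f a ->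
  is_derive x v (fun y => (f y)^-1) (- (f x) ^- 2 * a).
Proof.
move=> fx0 [df <-]; split; first exact: derivableV.
exact: deriveV.
Qed.

End ScalarDerive.

Section OneVariable.
Variable R : realType.
Implicit Types (f g G : R -> R) (U : set R) (j k : nat).

(** On the line the derivative in direction [v] is [v] times the one in direction 1, so a single
    derivative controls all of them. *)
Lemma Ck_is_derive k U f f' : open U ->
  (forall x, U x -> is_derive x 1 f (f' x)) -> Ck k U f' -> Ck k.+1 U f.
Proof.
move=> oU Df Cf'; have df x : U x -> differentiable f x.
  by move=> Ux; apply/derivable1_diffP; have [] := Df x Ux.
split=> // v; apply: (@eq_Ck _ _ _ _ _ (cst v * f')) => //.
  move=> x Ux; rewrite deriveE; last exact: df.
  rewrite -[v in RHS]mulr1 [RHS]linearZ -deriveE; last exact: df.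
  by have [_ ->] := Df x Ux.
by apply: CkM => //; exact: Ck_cst.
Qed.

Lemma Ck_powR k (a : R) : Ck k [set x : R | 0 < x] (fun x => x `^ a).
Proof.
elim: k a => [|k IH] a.
  move=> x /= x0; apply/differentiable_continuous/derivable1_diffP.
  by have [] := is_derive1_powR a x0.
have oP : open [set x : R | 0 < x] by exact: open_gt.
apply: (@Ck_is_derive k _ _ (cst a * (fun x => x `^ (a - 1)))) => //.
by apply: CkM => //; exact: Ck_cst.
Qed.

(** In effect an interval symmetric about 0: intermediate points between 0 and [t] remain in [U]. *)
Definition starlike U := forall x y, U x -> `|y| <= `|x| -> U y.

(** At 0 only continuity is asked, and the intermediate point avoids 0. This is the information
    available on [power_mean] while its derivative at 0 is still to be found. *)
Lemma MVT_origin U f f' t : starlike U -> U t -> t != 0 ->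
  (forall x, U x -> x != 0 -> is_derive x 1 f (f' x)) -> {for 0, continuous f} ->
  exists c, [/\ c != 0, `|c| < `|t| & f t - f 0 = f' c * t].
Proof.
move=> sU Ut t0 Df cf.
have cU x : U x -> {for x, continuous f}.
  have [-> //|x0 Ux] := eqVneq x 0.
  apply/differentiable_continuous/derivable1_diffP.
  by have [] := Df x Ux x0.
have [tpos|tneg|tE] := ltgtP 0 t; last by rewrite -tE eqxx in t0.
- have [|x xt|c] := @MVT R f f' 0 t tpos.
  + move=> x; rewrite in_itv /= => /andP[x0 xt]; apply: Df; last by rewrite gt_eqF.
    by apply: sU Ut _; rewrite !gtr0_norm // ltW.
  + apply: continuous_in_subspaceT => z; rewrite inE /= in_itv /= => /andP[z0 zt].
    by apply: cU; apply: sU Ut _; rewrite ger0_norm // gtr0_norm.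
  rewrite in_itv /= => /andP[c0 ct]; rewrite subr0 => E.
  by exists c; rewrite gt_eqF // !gtr0_norm.
- have [|x xt|c] := @MVT R f f' t 0 tneg.
  + move=> x; rewrite in_itv /= => /andP[tx x0]; apply: Df; last by rewrite lt_eqF.
    by apply: sU Ut _; rewrite !ltr0_norm // lerN2 ltW.
  + apply: continuous_in_subspaceT => z; rewrite inE /= in_itv /= => /andP[tz z0].
    by apply: cU; apply: sU Ut _; rewrite ler0_norm // ltr0_norm // lerN2.
  rewrite in_itv /= => /andP[tc c0]; rewrite sub0r => E.
  exists c; rewrite lt_eqF // !ltr0_norm // ltrN2; split => //.
  by rewrite -opprB E mulrN opprK.
Qed.

(* [power_mean j g G] is [t |-> \int_0^1 y^j g(ty) dy] when
   [G t = \int_0^t y^j g(y) dy]. *)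
Definition power_mean j g G (t : R) : R :=
  if t == 0 then g 0 / j.+1%:R else G t / t ^+ j.+1.

Section PowerMean.
Variables (U : set R) (j : nat) (g G : R -> R).
Hypotheses (oU : open U) (sU : starlike U) (U0 : U 0).
Hypothesis DG : forall x, U x -> is_derive x 1 G (x ^+ j * g x).
Hypothesis G0 : G 0 = 0.

(** Subtracting from [G] the primitive of x^j g(0) leaves [F] with derivative x^j (g(x) - g(0)). The
    mean value theorem and division by t^(j+1) bound the deviation by |c/t|^j |g(0) - g(c)| with |c|
    < |t|. *)
Lemma power_mean_continuous0 : {for 0, continuous g} ->
  {for 0, continuous (power_mean j g G)}.
Proof.
move=> cg; apply/cvgrPdist_le => e e0.
have /nbhs_ballP[d /= d0 gd] : \forall x \near (0 : R), `|g 0 - g x| <= e.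
  by move/cvgrPdist_le : cg => /(_ _ e0).
have UN : \forall x \near (0 : R), U x by exact: near_open U0 _.
have ND : \forall x \near (0 : R), `|x| < d by exact: nbhs0_lt.
near=> t.
have Ut : U t by near: t.
have td : `|t| < d.
  by near: t.
rewrite {1}/power_mean eqxx /power_mean; case: eqVneq => [_|t0].
  by rewrite subrr normr0 ltW.
pose F x := G x - (g 0 / j.+1%:R) * x ^+ j.+1.
have DF x : U x -> is_derive x 1 F (x ^+ j * (g x - g 0)).
  move=> Ux; have DX := is_derive_exp j.+1 (is_derive_id x (1 : R)).
  have := is_derive_add (DG Ux) (is_derive_scale (- (g 0 / j.+1%:R)) DX).
  rewrite /F; under [X in is_derive _ _ X]eq_fun do rewrite mulNr.
  by move/is_derive_eq; apply; rewrite /=; field.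
have [|c [c0 ct]] := @MVT_origin U F _ t sU Ut t0 (fun x Ux _ => DF x Ux).
  apply/differentiable_continuous/derivable1_diffP.
  by have [] := DF _ U0.
rewrite {1 2}/F G0 expr0n mulr0 subrr subr0 => E.
have -> : g 0 / j.+1%:R - G t / t ^+ j.+1 = (c / t) ^+ j * (g 0 - g c).
  apply: (mulIf (expf_neq0 j.+1 t0)).
  rewrite mulrBl divfK ?expf_neq0 // -opprB E expr_div_n exprS; field.
  by rewrite expf_neq0.
rewrite normrM -[leRHS]mul1r ler_pM //.
  rewrite normrX exprn_ile1 // normrM normfV ler_pdivrMr ?normr_gt0 //.
  by rewrite mul1r ltW.
by apply: gd; rewrite /ball /= sub0r normrN (lt_trans ct).
Unshelve. all: by end_near. Qed.

End PowerMean.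

Section PowerMeanDerive.
Variables (U : set R) (j : nat) (g g' G : R -> R).
Hypotheses (oU : open U) (sU : starlike U) (U0 : U 0).
Hypothesis DG : forall x, U x -> is_derive x 1 G (x ^+ j * g x).
Hypothesis G0 : G 0 = 0.
Hypothesis Dg : forall x, U x -> is_derive x 1 g (g' x).

(** Integration by parts: this is the primitive of x^(j+1) g'(x) that vanishes at 0, hence the right
    companion of [g'] in [power_mean j.+1]. *)
Let G1 (t : R) := t ^+ j.+1 * g t - j.+1%:R * G t.

Let G1_0 : G1 0 = 0.
Proof. by rewrite /G1 G0 expr0n mul0r mulr0 subrr. Qed.

Lemma is_derive_power_mean_num x : U x -> is_derive x 1 G1 (x ^+ j.+1 * g' x).
Proof.
move=> Ux; have DX := is_derive_exp j.+1 (is_derive_id x (1 : R)).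
have := is_derive_add (is_derive_mul DX (Dg Ux)) (is_derive_scale (- j.+1%:R) (DG Ux)).
rewrite /G1; under [X in is_derive _ _ X]eq_fun do rewrite mulNr.
by move/is_derive_eq; apply; rewrite /= exprS; ring.
Qed.

Lemma is_derive_power_mean_neq0 x : U x -> x != 0 ->
  is_derive x 1 (power_mean j g G) (power_mean j.+1 g' G1 x).
Proof.
move=> Ux x0; have xX0 n : x ^+ n != 0 by rewrite expf_neq0.
have DX := is_derive_exp j.+1 (is_derive_id x (1 : R)).
have := is_derive_mul (DG Ux)
  (@is_derive_inv _ _ (fun y : R => y ^+ j.+1) _ _ _ (xX0 j.+1) DX).
move=> /(@near_eq_is_derive _ _ _ _ (power_mean j g G)) H.
apply: is_derive_eq; [apply: H|].
  near=> y; have y0 : y != 0 by near: y; exact: near_open (@open_neq R 0) x0 _.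
  by rewrite /power_mean (negPf y0).
rewrite /power_mean (negPf x0) /G1 /= !(exprS x j.+1) (exprS x j).
move: (x ^+ j) (xX0 j) => z z0. field.
by rewrite x0 z0.
Unshelve. all: by end_near. Qed.

(** At 0 the difference quotient equals, by the mean value theorem, the candidate derivative at some
    c with |c| < |t|. The candidate is itself a power mean, so it is continuous at 0 and the limit
    exists. *)
Lemma is_derive_power_mean x : {for 0, continuous g'} -> U x ->
  is_derive x 1 (power_mean j g G) (power_mean j.+1 g' G1 x).
Proof.
move=> cg' Ux; have [->|x0] := eqVneq x 0; last exact: is_derive_power_mean_neq0.
have cg : {for 0, continuous g}.
  apply/differentiable_continuous/derivable1_diffP.
  by have [] := Dg U0.
have cq := power_mean_continuous0 oU sU U0 DG G0 cg.
have cq1 : {for 0, continuous (power_mean j.+1 g' G1)}.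
  exact: power_mean_continuous0 oU sU U0 is_derive_power_mean_num G1_0 cg'.
set q := power_mean j g G; set q1 := power_mean _ _ _ in cq1 *.
have UN : \forall x \near (0 : R), U x by exact: near_open U0 _.
have slope : (fun h => h^-1 *: ((q \o shift 0) (h *: 1) - q 0)) @ 0^' --> q1 0.
  apply/cvgrPdist_le => e e0.
  have /nbhs_ballP[d /= d0 qd] : \forall x \near (0 : R), `|q1 0 - q1 x| <= e.
    by move/cvgrPdist_le : cq1 => /(_ _ e0).
  have ND : \forall x \near (0 : R)^', `|x| < d by exact: dnbhs0_lt.
  have UN' : \forall x \near (0 : R)^', U x by exact: nbhs_dnbhs.
  near=> t.
  have Ut : U t by near: t.
  have td : `|t| < d by near: t.
  have t0 : t != 0 by near: t; exact: nbhs_dnbhs_neq.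
  have [c [c0 ct E]] := MVT_origin sU Ut t0 is_derive_power_mean_neq0 cq.
  rewrite /= addr0 [t *: 1]mulr1 E [_ *: _]mulrC mulfK //.
  by apply: qd; rewrite /ball /= sub0r normrN (lt_trans ct).
by split; [apply/cvg_ex; exists (q1 0)|exact: cvg_lim slope].
Unshelve. all: by end_near. Qed.

End PowerMeanDerive.
End OneVariable.

Section HadamardCk.
Variables (R : realType) (U : set R).
Hypotheses (oU : open U) (sU : starlike U) (U0 : U 0).

(** Differentiation sends the mean of (j, g) to that of (j + 1, g'), so the induction must leave
    [j], [g] and [G] free, and each step consumes one derivative of [g]. *)
Lemma Ck_power_mean k j (g G : R -> R) : (forall n, Ck n U g) ->
  (forall x, U x -> is_derive x 1 G (x ^+ j * g x)) -> G 0 = 0 ->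
  Ck k U (power_mean j g G).
Proof.
elim: k j g G => [|k IH] j g G Cg DG G0.
all: have Dg x : U x -> is_derive x 1 g ('D_1 g x).
1,3: by move=> Ux; split=> //; apply: diff_derivable; exact: (Cg 1%N).1.
all: have cg' : {for 0, continuous ('D_1 g)} by exact: (Cg 1%N).2 1 0 U0.
all: have Dq := is_derive_power_mean oU sU U0 DG G0 Dg cg'.
  move=> x Ux; apply/differentiable_continuous/derivable1_diffP.
  by have [] := Dq x Ux.
apply: Ck_is_derive oU Dq _; apply: IH => [n||].
- exact: (Cg n.+1).2.
- exact: is_derive_power_mean_num.
- by rewrite expr0n mul0r G0 mulr0 subrr.
Qed.

End HadamardCk.

(** * Smooth germs and their 1-jets *)

Section SmoothGerms.
Variable R : realType.
Implicit Types V W : normedModType R.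

Lemma smooth_germP V W (f : V -> W) (P : V -> Prop) :
  (\forall x \near (0 : V), P x) ->
  (forall U : set V, open U -> U `<=` P -> forall k, Ck k U f) -> smooth_germ f.
Proof.
move=> nP Cf; exists (P : set V)°; last first.
  by apply: Cf; [exact: open_interior|exact: interior_subset].
by split; [exact: open_interior|exact: nP].
Qed.

Lemma near_smooth_germ V W (f : V -> W) : smooth_germ f ->
  \forall x \near (0 : V), differentiable f x.
Proof.
by move=> [U [oU U0] Cf]; apply: near_open U0 _ => // x; exact: (Cf 1%N).1.
Qed.

Lemma differentiable_smooth_germ V W (f : V -> W) :
  smooth_germ f -> differentiable f 0.
Proof. by move/near_smooth_germ/nbhs_singleton. Qed.

Lemma smooth_germ_derive V W (f : V -> W) v : smooth_germ f -> smooth_germ ('D_v f).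
Proof. by move=> [U oU Cf]; exists U => // k; exact: (Cf k.+1).2. Qed.

Lemma smooth_germ_cst V W (a : W) : smooth_germ (cst a : V -> W).
Proof. by exists setT; [split => //; exact: openT|move=> k; exact: Ck_cst]. Qed.

Lemma smooth_germD V W (f g : V -> W) :
  smooth_germ f -> smooth_germ g -> smooth_germ (fun x => f x + g x).
Proof.
move=> [U [oU U0] Cf] [U' [oU' U'0] Cg].
exists (U `&` U'); first by split; [exact: openI|split].
by move=> k; apply: CkD; [exact: openI|exact: Ck_sub (Cf k)|exact: Ck_sub (Cg k)].
Qed.

Lemma smooth_germM V (f g : V -> R) :
  smooth_germ f -> smooth_germ g -> smooth_germ (fun x => f x * g x).
Proof.
move=> [U [oU U0] Cf] [U' [oU' U'0] Cg].
exists (U `&` U'); first by split; [exact: openI|split].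
by move=> k; apply: CkM; [exact: openI|exact: Ck_sub (Cf k)|exact: Ck_sub (Cg k)].
Qed.

Lemma smooth_germX V (f : V -> R) n :
  smooth_germ f -> smooth_germ (fun x => f x ^+ n).
Proof.
move=> sf; elim: n => [|n IH]; first exact: smooth_germ_cst.
by under eq_fun do rewrite exprS; exact: smooth_germM.
Qed.

Lemma smooth_germ_comp V W n (e : 'I_n -> V) (g : 'I_n -> W -> R) (f : V -> R)
    (O : set V) : open O -> O (lincomb e g 0) -> (forall k, Ck k O f) ->
  (forall i, smooth_germ (g i)) -> smooth_germ (f \o lincomb e g).
Proof.
move=> oO O0 Cf sg.
have /choice[U HU] i : exists U : set W, open_nbhs 0 U /\ forall k, Ck k U (g i).
  by have [U ? ?] := sg i; exists U.
apply: (@smooth_germP _ _ _ (fun x => (forall i, U i x) /\ O (lincomb e g x))).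
  near=> x; split; near: x.
    apply: filter_forall => i; have [[oUi Ui0] _] := HU i.
    exact: near_open Ui0 _.
  apply: (@continuous_lincomb _ _ _ _ e g 0) => [i|].
    exact/differentiable_continuous/differentiable_smooth_germ.
  exact: open_nbhs_nbhs.
move=> U' oU' U'P k; apply: (@Ck_comp _ _ _ _ _ _ _ O) => // [i|x /U'P[]//].
by have [_ Cg] := HU i; apply: Ck_sub (Cg k) => x /U'P[].
Unshelve. all: by end_near. Qed.

(** The cofactor is the mean of f'(t y) over y in [0, 1], with [f - f 0] as the primitive. Away from
    0 it is the plain quotient, so the factorization is valid for every [t] and can later be
    rewritten without any nearness condition. *)
Lemma hadamard (f : R -> R) : smooth_germ f -> exists f1 : R -> R,
  [/\ smooth_germ f1, f1 0 = 'D_1 f 0 & forall t, f t = f 0 + t * f1 t].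
Proof.
move=> [U [oU U0] Cf]; have /nbhs_ballP[r /= r0 rU] := open_nbhs_nbhs (conj oU U0).
have oB : open (ball (0 : R) r) by exact: ball_open.
have sB : starlike (ball (0 : R) r).
  by move=> x y; rewrite /ball /= !sub0r !normrN => xr yx; exact: le_lt_trans xr.
have B0 : ball (0 : R) r 0 by exact: ballxx.
pose G x := f x - f 0; exists (power_mean 0 ('D_1 f) G); split.
- exists (ball 0 r) => // k; apply: Ck_power_mean => // [n|x /rU Ux|].
  + by apply: Ck_sub rU _; exact: (Cf n.+1).2.
  + have Df : is_derive x 1 f ('D_1 f x).
      by split => //; apply: diff_derivable; exact: (Cf 1%N).1.
    have := is_derive_add Df (is_derive_cst (- f 0) x 1).
    by move/is_derive_eq; apply; rewrite addr0 expr0 mul1r.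
  + by rewrite /G subrr.
- by rewrite /power_mean eqxx divr1.
- move=> t; rewrite /power_mean; case: eqVneq => [->|t0].
    by rewrite mul0r addr0.
  by rewrite expr1 mulrC divfK // /G addrC subrK.
Qed.

End SmoothGerms.

(** * Calculus of 1-jets at 0 along curves *)

Section Jets.
Variable R : realType.
Implicit Types f g : R -> R.

(** Smoothness travels with the value and the slope, so that computing the coefficients of an
    expression also proves that its remainder is a smooth germ. *)
Definition jet f (a b : R) := [/\ smooth_germ f, f 0 = a & is_derive (0 : R) (1 : R) f b].

Lemma jet_smooth f : smooth_germ f -> jet f (f 0) ('D_1 f 0).
Proof.
by move=> sf; split=> //; split=> //; exact/diff_derivable/differentiable_smooth_germ.
Qed.

Lemma eq_jet f a b a' b' : jet f a b -> a = a' -> b = b' -> jet f a' b'.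
Proof. by move=> jf <- <-. Qed.

Lemma jet_cst a : jet (fun=> a) a 0.
Proof. by split => //; [exact: smooth_germ_cst|exact: is_derive_cst]. Qed.

Lemma smooth_germ_id : smooth_germ (id : R -> R).
Proof.
exists setT => [|k]; first by split => //; exact: openT.
have Did (x : R) : setT x -> is_derive x 1 id (cst 1 x) by move=> _; exact: is_derive_id.
by apply: CkW; exact: Ck_is_derive openT Did (@Ck_cst _ _ _ k _ _).
Qed.

Lemma jet_id : jet id 0 1.
Proof. by split => //; [exact: smooth_germ_id|exact: is_derive_id]. Qed.

Lemma jetD f g a b c d : jet f a b -> jet g c d ->
  jet (fun t => f t + g t) (a + c) (b + d).
Proof.
move=> [sf <- Df] [sg <- Dg]; split => //; first exact: smooth_germD.
exact: is_derive_add.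
Qed.

Lemma jetM f g a b c d : jet f a b -> jet g c d ->
  jet (fun t => f t * g t) (a * c) (a * d + c * b).
Proof.
move=> [sf <- Df] [sg <- Dg]; split => //; first exact: smooth_germM.
exact: is_derive_mul.
Qed.

Lemma jetN f a b : jet f a b -> jet (fun t => - f t) (- a) (- b).
Proof.
move=> jf; have := jetM (jet_cst (-1)) jf.
under eq_fun do rewrite mulN1r.
by move/eq_jet; apply; rewrite ?mulr0 ?addr0 mulN1r.
Qed.

Lemma jetX f a b n : jet f a b ->
  jet (fun t => f t ^+ n) (a ^+ n) (n%:R * a ^+ n.-1 * b).
Proof.
move=> [sf <- Df]; split => //; first exact: smooth_germX.
exact: is_derive_exp.
Qed.

(** The outer function is smooth on an open set around an arbitrary base point, not only at 0: the
    real powers of A, B and 4 W^2 are taken at positive values. *)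
Lemma jet_lincomb (V : normedModType R) n (e : 'I_n -> V) (f : V -> R)
    (g : 'I_n -> R -> R) (a b : 'I_n -> R) (O : set V) :
  let p := \sum_(i < n) a i *: e i in
  open O -> O p -> (forall k, Ck k O f) -> (forall i, jet (g i) (a i) (b i)) ->
  jet (fun t => f (\sum_(i < n) g i t *: e i)) (f p)
    (\sum_(i < n) b i * 'D_(e i) f p).
Proof.
move=> p oO Op Cf jg.
have p0 : lincomb e g 0 = p.
  by apply: eq_bigr => i _; have [_ -> _] := jg i.
have dg i : differentiable (g i) 0.
  by have [? _ _] := jg i; exact: differentiable_smooth_germ.
have df : differentiable f (lincomb e g 0) by rewrite p0; exact: (Cf 1%N).1.
split; last split.
- apply: (@smooth_germ_comp _ _ _ _ _ _ _ O) => // [|i]; first by rewrite p0.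
  by have [] := jg i.
- by rewrite -[in RHS]p0.
- by apply: diff_derivable; apply: differentiable_comp => //; exact: differentiable_lincomb.
- rewrite (derive_comp_lincomb _ dg df) p0; apply: eq_bigr => i _.
  by have [_ _ [_ ->]] := jg i.
Qed.

Lemma jet_powR f a b r : 0 < a -> jet f a b ->
  jet (fun t => f t `^ r) (a `^ r) (r * a `^ (r - 1) * b).
Proof.
move=> a0 jf.
have := @jet_lincomb R 1 (fun=> 1) (fun x => x `^ r) (fun=> f) (fun=> a) (fun=> b)
  [set x | 0 < x].
have oP : open [set x : R | 0 < x] by exact: open_gt.
rewrite /= !big_ord1 [a *: 1]mulr1 => /(_ oP a0 (fun k => Ck_powR k r) (fun=> jf)) J.
have -> : (fun t => f t `^ r) = (fun t => (\sum_(i < 1) f t *: (1 : R)) `^ r).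
  by apply/funext => t; rewrite big_ord1 [_ *: 1]mulr1.
apply: eq_jet J _ _ => //.
by have [_ ->] := is_derive1_powR r a0; rewrite mulrC.
Qed.

Lemma jet_comp f g b : smooth_germ f -> jet g 0 b ->
  jet (fun t => f (g t)) (f 0) (b * 'D_1 f 0).
Proof.
move=> [U [oU U0] Cf] jg.
have := @jet_lincomb R 1 (fun=> 1) f (fun=> g) (fun=> 0) (fun=> b) U.
rewrite /= !big_ord1 scale0r => /(_ oU U0 Cf (fun=> jg)).
by under eq_fun do rewrite big_ord1 [_ *: 1]mulr1.
Qed.

Lemma jet_comp2 (f : R * R -> R) g1 g2 b1 b2 : smooth_germ f ->
  jet g1 0 b1 -> jet g2 0 b2 ->
  jet (fun t => f (g1 t, g2 t)) (f (0, 0)) (b1 * pd1 f (0, 0) + b2 * pd2 f (0, 0)).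
Proof.
move=> [U [oU U0] Cf] j1 j2.
pose e (i : 'I_2) : R * R := [:: (1, 0); (0, 1)]`_i.
pose g (i : 'I_2) := nth g1 [:: g1; g2] i.
pose b (i : 'I_2) := [:: b1; b2]`_i.
have := @jet_lincomb _ 2 e f g (fun=> 0) b U; rewrite /=.
have -> : \sum_(i < 2) 0 *: e i = 0 by rewrite big1 // => i _; rewrite scale0r.
have jg i : jet (g i) 0 (b i) by case: i => -[|[|//]].
move=> /(_ oU U0 Cf jg); rewrite !big_ord_recl !big_ord0 addr0.
have -> // : (fun t => f (\sum_(i < 2) g i t *: e i)) = (fun t => f (g1 t, g2 t)).
apply/funext => t; rewrite !big_ord_recl big_ord0 addr0 /=; congr f.
by rewrite /e /g /=; congr pair; rewrite /= /GRing.scale /=; ring.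
Qed.

Lemma jet_comp3 (f : R * R * R -> R) g1 g2 g3 b1 b2 b3 : smooth_germ f ->
  jet g1 0 b1 -> jet g2 0 b2 -> jet g3 0 b3 ->
  jet (fun t => f (g1 t, g2 t, g3 t)) (f (0, 0, 0))
    (b1 * 'D_(1, 0, 0) f (0, 0, 0) + b2 * 'D_(0, 1, 0) f (0, 0, 0)
     + b3 * 'D_(0, 0, 1) f (0, 0, 0)).
Proof.
move=> [U [oU U0] Cf] j1 j2 j3.
pose e (i : 'I_3) : R * R * R := [:: (1, 0, 0); (0, 1, 0); (0, 0, 1)]`_i.
pose g (i : 'I_3) := nth g1 [:: g1; g2; g3] i.
pose b (i : 'I_3) := [:: b1; b2; b3]`_i.
have := @jet_lincomb _ 3 e f g (fun=> 0) b U; rewrite /=.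
have -> : \sum_(i < 3) 0 *: e i = 0 by rewrite big1 // => i _; rewrite scale0r.
have jg i : jet (g i) 0 (b i) by case: i => -[|[|[|//]]].
move=> /(_ oU U0 Cf jg); rewrite !big_ord_recl !big_ord0 addr0 !addrA.
have -> // : (fun t => f (\sum_(i < 3) g i t *: e i)) = (fun t => f (g1 t, g2 t, g3 t)).
apply/funext => t; rewrite !big_ord_recl big_ord0 addr0 /=; congr f.
by rewrite /e /g /=; congr pair; [congr pair|]; rewrite /= /GRing.scale /=; ring.
Qed.

Lemma jet_Osmooth1 f a b : jet f a b -> Osmooth 1 (fun t => f t - a).
Proof.
move=> [/hadamard[f1 [sf1 _ fE]] <- _]; exists f1 => //.
by near=> t; rewrite [in LHS]fE expr1 addrC addKr.
Unshelve. all: by end_near. Qed.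

(** Hadamard's lemma twice: the first cofactor takes the value [b] at 0, and the second one is the
    cofactor of t^2. *)
Lemma jet_Osmooth2 f a b : jet f a b -> Osmooth 2 (fun t => f t - a - b * t).
Proof.
move=> [/hadamard[f1 [sf1 f10 fE]] <- [_ Df]].
have [f2 [sf2 _ f1E]] := hadamard sf1; exists f2 => //.
by near=> t; rewrite [in LHS]fE f1E f10 Df; ring.
Unshelve. all: by end_near. Qed.

End Jets.

(** * Germs composed with linear maps *)

Section Pullback.
Variables (R : realType) (V W X : normedModType R) (L : W -> V).
Hypotheses (linL : linear L) (diffL : forall x, differentiable L x).
Implicit Types (f : V -> X) (x v : W).

(** The two difference quotients are the same function of [h], so the limits agree for any [f]. This
    serves the linear pullbacks as well as the affine slices s = const. *)
Lemma derive_affine (A : W -> V) f x v w :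
  (forall h : R, A (h *: v + x) = h *: w + A x) ->
  'D_v (f \o A) x = 'D_w f (A x).
Proof.
move=> AE; rewrite /derive; set g1 := fun h => h^-1 *: _; set g2 := fun h => h^-1 *: _.
by have -> : g1 = g2 by apply/funext => h; rewrite /g1 /g2 /= AE.
Qed.

Lemma derive_pullback f v : 'D_v (f \o L) = 'D_(L v) f \o L.
Proof. by apply/funext => x; apply: derive_affine => h; rewrite linL. Qed.

Lemma pullback0 : L 0 = 0.
Proof. by have := linL (-1) 0 0; rewrite !scaleN1r !addNr. Qed.

Lemma near_pullback (P : V -> Prop) :
  (\forall y \near (0 : V), P y) -> \forall x \near (0 : W), P (L x).
Proof.
have : {for 0, continuous L} by exact/differentiable_continuous/diffL.
by rewrite /prop_for /continuous_at pullback0; apply.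
Qed.

Lemma Ck_pullback k (U : set V) f : Ck k U f -> Ck k (L @^-1` U) (f \o L).
Proof.
elim: k f => [|k IH] f /=.
  move=> cf x Ux; apply: continuous_comp; last exact: cf.
  exact/differentiable_continuous/diffL.
move=> [df Df]; split=> [x Ux|v]; last by rewrite derive_pullback; exact: IH.
by apply: differentiable_comp; [exact: diffL|exact: df].
Qed.

Lemma smooth_germ_pullback f : smooth_germ f -> smooth_germ (f \o L).
Proof.
move=> [U [oU U0] Cf]; exists (L @^-1` U); last by move=> k; exact: Ck_pullback.
split; last by rewrite /= pullback0.
apply: open_comp => // x _; exact/differentiable_continuous/diffL.
Qed.

End Pullback.

(** * Explicit derivatives of germs in a fixed direction *)

Section GermDerive.
Variable R : realType.
Implicit Types V W : normedModType R.

(** Including the smoothness of [f'] lets an explicit formula for a derivative be multiplied and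
    differentiated again. *)
Definition germ_derive V (v : V) (f f' : V -> R) :=
  [/\ smooth_germ f, smooth_germ f' & \forall x \near (0 : V), is_derive x v f (f' x)].

Lemma germ_derive_smooth V (v : V) (f : V -> R) :
  smooth_germ f -> germ_derive v f ('D_v f).
Proof.
move=> sf; split=> //; first exact: smooth_germ_derive.
apply: filterS (near_smooth_germ sf) => x dfx.
by split=> //; exact: diff_derivable.
Qed.

Lemma germ_derive_ex V (v : V) (f : V -> R) :
  smooth_germ f -> exists f', germ_derive v f f'.
Proof. by exists ('D_v f); exact: germ_derive_smooth. Qed.

Lemma germ_derive_zero V (f : V -> R) : smooth_germ f -> germ_derive 0 f (cst 0).
Proof.
move=> sf; split => //; first exact: smooth_germ_cst.
by near=> x; exact: is_derive0.
Unshelve. all: by end_near. Qed.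

Lemma germ_derive_cst V (v : V) (a : R) : germ_derive v (cst a) (cst 0).
Proof.
split; [exact: smooth_germ_cst|exact: smooth_germ_cst|near=> x].
exact: is_derive_cst.
Unshelve. all: by end_near. Qed.

Lemma germ_deriveD V (v : V) (f f' g g' : V -> R) :
  germ_derive v f f' -> germ_derive v g g' ->
  germ_derive v (fun x => f x + g x) (fun x => f' x + g' x).
Proof.
move=> [sf sf' Df] [sg sg' Dg]; split; [exact: smooth_germD|exact: smooth_germD|].
by apply: filterS2 Df Dg => x; exact: is_derive_add.
Qed.

Lemma germ_deriveM V (v : V) (f f' g g' : V -> R) :
  germ_derive v f f' -> germ_derive v g g' ->
  germ_derive v (fun x => f x * g x) (fun x => f x * g' x + g x * f' x).
Proof.
move=> [sf sf' Df] [sg sg' Dg]; split; first exact: smooth_germM.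
  by apply: smooth_germD; exact: smooth_germM.
by apply: filterS2 Df Dg => x; exact: is_derive_mul.
Qed.

Lemma eq_germ_derive V (v : V) (f f' g g' : V -> R) :
  germ_derive v f f' -> (forall x, f x = g x) -> (forall x, f' x = g' x) ->
  germ_derive v g g'.
Proof. by move=> Df /funext <- /funext <-. Qed.

Lemma germ_derive_pullback V W (L : W -> V) (v : W) (f f' : V -> R) : linear L ->
  (forall x, differentiable L x) ->
  germ_derive (L v) f f' -> germ_derive v (fun x => f (L x)) (fun x => f' (L x)).
Proof.
move=> linL dL [sf sf' Df].
split; [exact: smooth_germ_pullback|exact: smooth_germ_pullback|].
move: (near_pullback linL dL (near_smooth_germ sf)) (near_pullback linL dL Df).
apply: filterS2 => x dfx [_ <-]; split.
  by apply: diff_derivable; exact: differentiable_comp.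
by apply: (@derive_affine _ _ _ _ L) => h; rewrite linL.
Qed.

(** An identity valid near 0 is valid near each point close to 0 ([near_join]), hence may be
    differentiated. *)
Lemma near_derive_near V W (v : V) (f g : V -> W) :
  (\forall x \near (0 : V), f x = g x) -> \forall x \near (0 : V), 'D_v f x = 'D_v g x.
Proof. by move=> /near_join; apply: filterS => x; exact: near_eq_derive. Qed.

Lemma derive_vec3 V (v : V) (f1 f2 f3 g1 g2 g3 : V -> R) :
  germ_derive v f1 g1 -> germ_derive v f2 g2 -> germ_derive v f3 g3 ->
  \forall x \near (0 : V),
    'D_v (fun y => vec3 (f1 y) (f2 y) (f3 y)) x = vec3 (g1 x) (g2 x) (g3 x).
Proof.
move=> [_ _ D1] [_ _ D2] [_ _ D3]; near=> x.
have H1 : is_derive x v f1 (g1 x) by near: x.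
have H2 : is_derive x v f2 (g2 x) by near: x.
have H3 : is_derive x v f3 (g3 x) by near: x.
have H j : is_derive x v (fun y => vec3 (f1 y) (f2 y) (f3 y) 0 j)
    (vec3 (g1 x) (g2 x) (g3 x) 0 j).
  rewrite mxE; under eq_fun do rewrite mxE.
  by case: j => -[|[|[|//]]].
rewrite derive_mx; last first.
  by apply/derivable_mxP => i j; rewrite ord1; have [] := H j.
by apply/matrixP => i j; rewrite ord1 mxE; have [_ ->] := H j.
Unshelve. all: by end_near. Qed.

End GermDerive.

(** * Derivatives of the deformation on the u-axis *)

Section Projections.
Variables (R : realType) (V W : normedModType R).

Lemma differentiable_fst (x : V * W) : differentiable fst x.
Proof. by apply: linear_differentiable => y; exact: cvg_fst. Qed.

Lemma differentiable_snd (x : V * W) : differentiable snd x.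
Proof. by apply: linear_differentiable => y; exact: cvg_snd. Qed.

End Projections.

Section AxisCurve.
Variable R : realType.
Implicit Types (g : R -> R) (k : R * R -> R) (x : R * R).
Local Notation e1 := ((1, 0) : R * R).

(** The common shape of the second and third components of the deformation at v = 0, with (f21, f24)
    and (f31, f34) for (g, k). *)
Definition axis g k x : R := x.1 ^+ 2 * g x.1 + x.1 * x.2 * k x.

Definition axis_u g k x : R :=
  2 * x.1 * g x.1 + x.1 ^+ 2 * 'D_1 g x.1 + x.2 * k x + x.1 * x.2 * pd1 k x.

Definition axis_uu g k x : R :=
  2 * g x.1 + 4 * x.1 * 'D_1 g x.1 + x.1 ^+ 2 * 'D_1 ('D_1 g) x.1
  + 2 * x.2 * pd1 k x + x.1 * x.2 * pd1 (pd1 k) x.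

Lemma germ_derive_id (v : R) : germ_derive v id (cst v).
Proof.
split; [exact: smooth_germ_id|exact: smooth_germ_cst|near=> x].
exact: is_derive_id.
Unshelve. all: by end_near. Qed.

Lemma germ_derive_fst g : smooth_germ g ->
  germ_derive e1 (fun x => g x.1) (fun x => 'D_1 g x.1).
Proof.
move=> sg; apply: (@germ_derive_pullback _ _ _ fst e1 g ('D_1 g)) => [//|x|].
  exact: differentiable_fst.
exact: germ_derive_smooth.
Qed.

Lemma germ_derive_coord1 : germ_derive e1 fst (cst 1).
Proof.
apply: (@germ_derive_pullback _ _ _ fst e1 id (cst 1)) => [//|x|].
  exact: differentiable_fst.
exact: germ_derive_id.
Qed.

Lemma germ_derive_coord2 : germ_derive e1 snd (cst 0).
Proof.
apply: (@germ_derive_pullback _ _ _ snd e1 id (cst 0)) => [//|x|].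
  exact: differentiable_snd.
exact: germ_derive_id.
Qed.

Lemma germ_derive_axis g k : smooth_germ g -> smooth_germ k ->
  germ_derive e1 (axis g k) (axis_u g k).
Proof.
move=> sg sk; have G := germ_derive_fst sg; have K := germ_derive_smooth e1 sk.
have U := germ_derive_coord1; have S := germ_derive_coord2.
have := germ_deriveD (germ_deriveM (germ_deriveM U U) G)
  (germ_deriveM (germ_deriveM U S) K).
by move/eq_germ_derive; apply=> x; rewrite /axis /axis_u /pd1 /cst; ring.
Qed.

Lemma germ_derive_axis_u g k : smooth_germ g -> smooth_germ k ->
  germ_derive e1 (axis_u g k) (axis_uu g k).
Proof.
move=> sg sk; have G := germ_derive_fst sg; have K := germ_derive_smooth e1 sk.
have G1 := germ_derive_fst (smooth_germ_derive (1 : R) sg).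
have K1 := germ_derive_smooth e1 (smooth_germ_derive e1 sk).
have U := germ_derive_coord1; have S := germ_derive_coord2.
have := germ_deriveD (germ_deriveD (germ_deriveD
  (germ_deriveM (germ_deriveM (germ_derive_cst e1 2) U) G)
  (germ_deriveM (germ_deriveM U U) G1)) (germ_deriveM S K))
  (germ_deriveM (germ_deriveM U S) K1).
move/eq_germ_derive; apply=> x; rewrite /axis_u /axis_uu /pd1 /cst.
  by move: (k x) ('D_1 g x.1) ('D_e1 k x) => a b c; ring.
move: (k x) ('D_1 g x.1) ('D_1 ('D_1 g) x.1) ('D_e1 k x) ('D_e1 ('D_e1 k) x).
by move=> a b c d e; ring.
Qed.

End AxisCurve.

Section DeformationDerivatives.
Variable R : realType.
Local Notation R3 := (R * R * R)%type.
Local Notation e1 := ((1, 0, 0) : R3).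
Local Notation e2 := ((0, 1, 0) : R3).

Let us_part (x : R3) : R * R := (x.1.1, x.2).

Let us_part_linear : linear us_part.
Proof. by []. Qed.

Let differentiable_us_part x : differentiable us_part x.
Proof.
apply: differentiable_pair; last exact: differentiable_snd.
by apply: (@differentiable_comp _ _ _ _ fst fst); exact: differentiable_fst.
Qed.

Lemma near_us (P : R * R -> Prop) :
  (\forall y \near (0 : R * R), P y) -> \forall x \near (0 : R3), P (x.1.1, x.2).
Proof. exact: (near_pullback us_part_linear differentiable_us_part). Qed.

Lemma germ_derive_u (f f' : R * R -> R) : germ_derive ((1, 0) : R * R) f f' ->
  germ_derive e1 (fun x => f (x.1.1, x.2)) (fun x => f' (x.1.1, x.2)).
Proof. by move=> Df; exact: (@germ_derive_pullback _ _ _ us_part e1 f f'). Qed.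

Lemma germ_derive_v (f : R * R -> R) : smooth_germ f ->
  germ_derive e2 (fun x => f (x.1.1, x.2)) (cst 0).
Proof.
move=> sf; apply: (@germ_derive_pullback _ _ _ us_part e2 f (cst 0)) => //.
exact: germ_derive_zero.
Qed.

Let v_part (x : R3) : R := x.1.2.

Lemma germ_derive_coord_v (v : R3) : germ_derive v (fun x => x.1.2) (cst v.1.2).
Proof.
apply: (@germ_derive_pullback _ _ _ v_part v id (cst v.1.2)) => [//|x|].
  by apply: (@differentiable_comp _ _ _ _ fst snd);
    [exact: differentiable_fst|exact: differentiable_snd].
exact: germ_derive_id.
Qed.

Variables (f21 f31 : R -> R) (f24 f33 f34 : R * R -> R) (f32 : R3 -> R).
Hypotheses (s21 : smooth_germ f21) (s31 : smooth_germ f31) (s24 : smooth_germ f24).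
Hypotheses (s33 : smooth_germ f33) (s34 : smooth_germ f34) (s32 : smooth_germ f32).

Let F := S1_deformation f21 f31 f24 f33 f34 f32.

Let FE : F = fun x => vec3 x.1.1 (axis f21 f24 (x.1.1, x.2) + x.1.2 * x.1.2)
  (axis f31 f34 (x.1.1, x.2) + x.1.2 * x.1.2 * f32 x + x.1.2 * f33 (x.1.1, x.2)).
Proof.
apply/funext => -[[u v] s]; rewrite /F /S1_deformation /axis /=.
by congr vec3; ring.
Qed.

Lemma S1_derivatives_on_axis : \forall x \near (0 : R3), x.1.2 = 0 ->
  let y := (x.1.1, x.2) in
  [/\ 'D_e1 F x = vec3 1 (axis_u f21 f24 y) (axis_u f31 f34 y),
      'D_e1 ('D_e1 F) x = vec3 0 (axis_uu f21 f24 y) (axis_uu f31 f34 y),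
      'D_e2 ('D_e1 F) x = vec3 0 0 (pd1 f33 y) &
      'D_e2 ('D_e2 F) x = vec3 0 2 (2 * f32 x)].
Proof.
move: F FE => G GE.
have sa2 := germ_derive_axis s21 s24; have sa3 := germ_derive_axis s31 s34.
have sb2 := germ_derive_axis_u s21 s24; have sb3 := germ_derive_axis_u s31 s34.
have [sA2 sB2 _] := sa2; have [sA3 sB3 _] := sa3.
have U1 := germ_derive_u (germ_derive_coord1 R).
have U2 : germ_derive e2 (fun x : R3 => x.1.1) (cst 0).
  by apply: (germ_derive_v (f := fst)); have [] := germ_derive_coord1 R.
have V1 := germ_derive_coord_v e1; have V2 := germ_derive_coord_v e2.
have [p1 P1] := germ_derive_ex e1 s32; have [p2 P2] := germ_derive_ex e2 s32.
have [_ sp1 _] := P1; have [_ sp2 _] := P2.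
have [p11 P11] := germ_derive_ex e1 sp1; have [p12 P12] := germ_derive_ex e2 sp1.
have [p22 P22] := germ_derive_ex e2 sp2.
have C2 := germ_derive_v s33.
have : germ_derive ((1, 0) : R * R) f33 (pd1 f33) by exact: germ_derive_smooth.
move: (pd1 f33) => w Dw; have [_ sw _] := Dw.
have C1 := germ_derive_u Dw; have C12 := germ_derive_v sw.
have [w1 /germ_derive_u C11] := germ_derive_ex ((1, 0) : R * R) sw.
have A2 := germ_derive_u sa2; have A3 := germ_derive_u sa3.
have B2 := germ_derive_u sb2; have B3 := germ_derive_u sb3.
have A2' := germ_derive_v sA2; have A3' := germ_derive_v sA3.
have B2' := germ_derive_v sB2; have B3' := germ_derive_v sB3.
have c0 (v : R3) (a : R) := germ_derive_cst v a.
(* The first derivatives are needed for all small v, since they are differentiated once more in v; v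
   = 0 is imposed only on the second derivatives. *)
pose F_u x := vec3 1 (axis_u f21 f24 (x.1.1, x.2)) (axis_u f31 f34 (x.1.1, x.2)
  + x.1.2 * x.1.2 * p1 x + x.1.2 * w (x.1.1, x.2)).
pose F_v x := vec3 0 (2 * x.1.2) (2 * x.1.2 * f32 x
  + x.1.2 * x.1.2 * p2 x + f33 (x.1.1, x.2)).
have Fu : \forall x \near (0 : R3), 'D_e1 G x = F_u x.
  rewrite GE; apply: derive_vec3; first exact: U1.
  - apply: (eq_germ_derive (germ_deriveD A2 (germ_deriveM V1 V1))) => // x.
    by rewrite /cst /=; ring.
  - apply: (eq_germ_derive (germ_deriveD (germ_deriveD A3
      (germ_deriveM (germ_deriveM V1 V1) P1)) (germ_deriveM V1 C1))) => // x.
    by rewrite /cst /pd1 /=; ring.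
have Fv : \forall x \near (0 : R3), 'D_e2 G x = F_v x.
  rewrite GE; apply: derive_vec3; first exact: U2.
  - apply: (eq_germ_derive (germ_deriveD A2' (germ_deriveM V2 V2))) => // x.
    by rewrite /cst /=; ring.
  - apply: (eq_germ_derive (germ_deriveD (germ_deriveD A3'
      (germ_deriveM (germ_deriveM V2 V2) P2)) (germ_deriveM V2 C2))) => // x.
    by rewrite /cst /=; ring.
have Fuu : \forall x \near (0 : R3), x.1.2 = 0 -> 'D_e1 F_u x =
    vec3 0 (axis_uu f21 f24 (x.1.1, x.2)) (axis_uu f31 f34 (x.1.1, x.2)).
  have := derive_vec3 (c0 e1 1) B2 (germ_deriveD (germ_deriveD B3
      (germ_deriveM (germ_deriveM V1 V1) P11)) (germ_deriveM V1 C11)).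
  apply: filterS => x E v0; rewrite [LHS]E; congr vec3.
  by rewrite /cst /= v0; ring.
have Fuv : \forall x \near (0 : R3), x.1.2 = 0 -> 'D_e2 F_u x =
    vec3 0 0 (w (x.1.1, x.2)).
  have := derive_vec3 (c0 e2 1) B2' (germ_deriveD (germ_deriveD B3'
      (germ_deriveM (germ_deriveM V2 V2) P12)) (germ_deriveM V2 C12)).
  apply: filterS => x E v0; rewrite [LHS]E; congr vec3.
  by rewrite /cst /= v0; ring.
have Fvv : \forall x \near (0 : R3), x.1.2 = 0 -> 'D_e2 F_v x =
    vec3 0 2 (2 * f32 x).
  have := derive_vec3 (c0 e2 0) (germ_deriveM (c0 e2 2) V2) (germ_deriveD (germ_deriveD
      (germ_deriveM (germ_deriveM (c0 e2 2) V2) P2)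
      (germ_deriveM (germ_deriveM V2 V2) P22)) C2).
  apply: filterS => x E v0; rewrite [LHS]E; congr vec3.
    by rewrite /cst /=; ring.
  by rewrite /cst /= v0; ring.
have Eu1 := near_derive_near e1 Fu; have Eu2 := near_derive_near e2 Fu.
have Ev2 := near_derive_near e2 Fv.
near=> x; move=> v0; split.
- apply: etrans (near Fu x _) _ => //.
  by rewrite /F_u v0 !mul0r !addr0.
- exact: etrans (near Eu1 x _) (near Fuu x _ v0).
- exact: etrans (near Eu2 x _) (near Fuv x _ v0).
- exact: etrans (near Ev2 x _) (near Fvv x _ v0).
Unshelve. all: by end_near. Qed.

End DeformationDerivatives.

(** * Whitney umbrella invariants *)

Section UmbrellaInvariants.
Variable R : realType.
Implicit Types (a b c : R).

Lemma dot3_vec3 a b c a' b' c' :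
  dot3 (vec3 a b c) (vec3 a' b' c') = a * a' + b * b' + c * c'.
Proof. by rewrite /dot3 !big_ord_recl big_ord0 !mxE /= addr0 addrA. Qed.

Lemma cross3_vec3 a b c a' b' c' : cross3 (vec3 a b c) (vec3 a' b' c') =
  vec3 (b * c' - c * b') (c * a' - a * c') (a * b' - b * a').
Proof. by rewrite /cross3 !mxE. Qed.

Lemma det3_vec3 a b c a' b' c' a'' b'' c'' :
  det3 (vec3 a b c) (vec3 a' b' c') (vec3 a'' b'' c'') =
  a * (b' * c'' - c' * b'') - b * (a' * c'' - c' * a'') + c * (a' * b'' - b' * a'').
Proof.
rewrite /det3 (expand_det_row _ 0) !big_ord_recl big_ord0 /cofactor.
rewrite !(expand_det_row _ 0) !big_ord_recl !big_ord0 /cofactor.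
rewrite !det_mx11 !mxE /=; ring.
Qed.

(** The zeros express that the first component is u and that the second one contains v only through
    the summand v^2. *)
Record umbrella_jet (h : R * R -> 'rV[R]_3) (x : R * R) (p q P Q w m : R) : Prop := {
  umbrella_u : pd1 h x = vec3 1 p q;
  umbrella_uu : pd1 (pd1 h) x = vec3 0 P Q;
  umbrella_uv : pd2 (pd1 h) x = vec3 0 0 w;
  umbrella_vv : pd2 (pd2 h) x = vec3 0 2 m }.

Section Coefficients.
Variables p q P Q w m : R.

Definition umbrella_A := 1 + p ^+ 2 + q ^+ 2.
Definition umbrella_B := 4 + m ^+ 2 + (p * m - 2 * q) ^+ 2.
(** The determinant |h_u, h_uu, h_vv|. *)
Definition umbrella_N := P * m - 2 * Q.
Definition umbrella_D := umbrella_N ^+ 2 + 8 * w ^+ 2 * P.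
Definition umbrella_E :=
  - 4 * w ^+ 2 * (umbrella_A * m - q * (2 * p + m * q)) - umbrella_B * umbrella_N.

Lemma umbrella_jetP h x : umbrella_jet h x p q P Q w m ->
  [/\ WA h x = umbrella_A, WB h x = umbrella_B, WC h x = - 2 * w,
      WD h x = umbrella_D & WE h x = umbrella_E].
Proof.
case=> hu huu huv hvv.
have E (f : 'rV[R]_3 -> 'rV[R]_3 -> 'rV[R]_3 -> 'rV[R]_3 -> R) :
    f (pd1 h x) (pd1 (pd1 h) x) (pd2 (pd1 h) x) (pd2 (pd2 h) x)
    = f (vec3 1 p q) (vec3 0 P Q) (vec3 0 0 w) (vec3 0 2 m) by exact: f_equal4.
rewrite /umbrella_D /umbrella_E /umbrella_A /umbrella_B /umbrella_N; split.
- rewrite [LHS](E (fun hu _ _ _ => dot3 hu hu)) dot3_vec3; ring.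
- rewrite [LHS](E (fun hu _ _ hvv => let n := cross3 hu hvv in dot3 n n)).
  by rewrite /= cross3_vec3 dot3_vec3; ring.
- by rewrite [LHS](E (fun hu _ huv hvv => det3 hu huv hvv)) det3_vec3; ring.
- rewrite [LHS](E (fun hu huu huv hvv =>
    det3 hu huu hvv ^+ 2 + 4 * det3 hu huv hvv * det3 hu huv huu)).
  by rewrite !det3_vec3; ring.
- rewrite [LHS](E (fun hu huu huv hvv => let n := cross3 hu hvv in
    2 * det3 hu huv hvv * (dot3 hu hu * dot3 hvv huv - dot3 hu huv * dot3 hvv hu)
    - dot3 n n * det3 hu huu hvv)).
  by rewrite /= !det3_vec3 cross3_vec3 !dot3_vec3; ring.
Qed.

End Coefficients.

(** Supplying the jets of both [h] and its reflection covers the two branches of [adapted], so the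
    sign of [WC = -2 w] never has to be decided. *)
Lemma whitney_umbrella_jet h x p q P Q w m :
  umbrella_jet h x p q P Q w m ->
  umbrella_jet (fun y => h (y.1, - y.2)) (x.1, - x.2) p q P Q (- w) m ->
  let A := umbrella_A p q in let B := umbrella_B p q m in
  [/\ whitney_a20 h x = 1 / 4 * A `^ (- (3 / 2)) * B `^ (1 / 2)
        * (4 * w ^+ 2)^-1 * umbrella_D P Q w m,
      whitney_a11 h x = 1 / 2 * A `^ (- (1 / 2)) * (4 * w ^+ 2)^-1
        * umbrella_E p q P Q w m &
      whitney_a02 h x = A `^ (1 / 2) * B `^ (3 / 2) * (4 * w ^+ 2)^-1].
Proof.
move=> /umbrella_jetP[A1 B1 C1 D1 E1] /umbrella_jetP[A2 B2 C2 D2 E2] A B.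
have CE : (- 2 * w) ^- 2 = (4 * w ^+ 2)^-1 by congr (_^-1); ring.
have CE' : (- 2 * - w) ^- 2 = (4 * w ^+ 2)^-1 by congr (_^-1); ring.
rewrite /whitney_a20 /whitney_a11 /whitney_a02 /adapted.
case: ifP => _.
  by rewrite A1 B1 C1 D1 E1 CE.
by rewrite A2 B2 C2 D2 E2 CE' /umbrella_D /umbrella_E sqrrN.
Qed.

End UmbrellaInvariants.

Section UmbrellasOfDeformation.
Variable R : realType.
Local Notation R3 := (R * R * R)%type.

Let flip (x : R3) : R3 := (x.1.1, - x.1.2, x.2).

Lemma smooth_germ_flip (f : R3 -> R) : smooth_germ f ->
  smooth_germ (fun x => f (x.1.1, - x.1.2, x.2)).
Proof.
apply: (@smooth_germ_pullback _ _ _ _ flip) => [a x y|x].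
  by rewrite /flip /= opprD -scalerN.
apply: differentiable_pair; last exact: differentiable_snd.
apply: differentiable_pair.
  by apply: (@differentiable_comp _ _ _ _ fst fst); exact: differentiable_fst.
apply: differentiableN.
by apply: (@differentiable_comp _ _ _ _ fst snd);
  [exact: differentiable_fst|exact: differentiable_snd].
Qed.

Let slice (s : R) (y : R * R) : R3 := (y.1, y.2, s).

Let slice_affine s (v : R * R) a x :
  slice s (a *: v + x) = a *: ((v.1, v.2, 0) : R3) + slice s x.
Proof.
by congr pair; rewrite -[LHS]add0r; congr (_ + _); rewrite [RHS]mulr0.
Qed.

(** Derivatives are computed in all three variables and restricted to slices afterwards. A
    neighbourhood of the origin of R^3 then serves all small values of s simultaneously. *)
Lemma pd1_slice (F : R3 -> 'rV[R]_3) (s : R) :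
  pd1 (F \o slice s) = 'D_((1, 0, 0) : R3) F \o slice s.
Proof. by apply/funext => x; apply: derive_affine => a; exact: slice_affine. Qed.

Lemma pd2_slice (F : R3 -> 'rV[R]_3) (s : R) :
  pd2 (F \o slice s) = 'D_((0, 1, 0) : R3) F \o slice s.
Proof. by apply/funext => x; apply: derive_affine => a; exact: slice_affine. Qed.

Variables (f21 f31 : R -> R) (f24 f34 : R * R -> R).
Hypotheses (s21 : smooth_germ f21) (s31 : smooth_germ f31).
Hypotheses (s24 : smooth_germ f24) (s34 : smooth_germ f34).

Lemma umbrella_jet_S1 (f33 : R * R -> R) (f32 : R3 -> R) :
  smooth_germ f33 -> smooth_germ f32 ->
  \forall x \near (0 : R3), x.1.2 = 0 ->
  let y := (x.1.1, x.2) in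
  umbrella_jet (fun z => S1_deformation f21 f31 f24 f33 f34 f32 (z.1, z.2, x.2)) x.1
    (axis_u f21 f24 y) (axis_u f31 f34 y) (axis_uu f21 f24 y) (axis_uu f31 f34 y)
    (pd1 f33 y) (2 * f32 x).
Proof.
move=> s33 s32; have := S1_derivatives_on_axis s21 s31 s24 s33 s34 s32.
move: (S1_deformation _ _ _ _ _ _) => F.
apply: filterS => x H /H[Hu Huu Huv Hvv].
have slE : slice x.2 x.1 = x by case: {H Hu Huu Huv Hvv} x => -[].
change (umbrella_jet (F \o slice x.2) x.1 (axis_u f21 f24 (x.1.1, x.2))
  (axis_u f31 f34 (x.1.1, x.2)) (axis_uu f21 f24 (x.1.1, x.2))
  (axis_uu f31 f34 (x.1.1, x.2)) (pd1 f33 (x.1.1, x.2)) (2 * f32 x)).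
split; rewrite (pd1_slice F) || rewrite (pd2_slice F).
- by rewrite -[RHS]Hu; exact: (congr1 ('D_((1, 0, 0) : R3) F)) slE.
- rewrite (pd1_slice ('D_((1, 0, 0) : R3) F)) -[RHS]Huu.
  exact: (congr1 ('D_((1, 0, 0) : R3) ('D_((1, 0, 0) : R3) F))) slE.
- rewrite (pd2_slice ('D_((1, 0, 0) : R3) F)) -[RHS]Huv.
  exact: (congr1 ('D_((0, 1, 0) : R3) ('D_((1, 0, 0) : R3) F))) slE.
- rewrite (pd2_slice ('D_((0, 1, 0) : R3) F)) -[RHS]Hvv.
  exact: (congr1 ('D_((0, 1, 0) : R3) ('D_((0, 1, 0) : R3) F))) slE.
Qed.

(** Replacing v by -v gives a deformation of the same shape, with -f33 and f32(u, -v, s) in place of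
    f33 and f32. Hence [umbrella_jet_S1], stated for arbitrary [f33] and [f32], also provides the
    jet of the reflected umbrella. *)
Lemma whitney_S1 (f33 : R * R -> R) (f32 : R3 -> R) :
  smooth_germ f33 -> smooth_germ f32 ->
  \forall x \near (0 : R3), x.1.2 = 0 ->
  let y := (x.1.1, x.2) in
  let h (z : R * R) := S1_deformation f21 f31 f24 f33 f34 f32 (z.1, z.2, x.2) in
  let p := axis_u f21 f24 y in let q := axis_u f31 f34 y in
  let P := axis_uu f21 f24 y in let Q := axis_uu f31 f34 y in
  let w := pd1 f33 y in let m := 2 * f32 x in
  let A := umbrella_A p q in let B := umbrella_B p q m in
  [/\ whitney_a20 h x.1 = 1 / 4 * A `^ (- (3 / 2)) * B `^ (1 / 2)
        * (4 * w ^+ 2)^-1 * umbrella_D P Q w m,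
      whitney_a11 h x.1 = 1 / 2 * A `^ (- (1 / 2)) * (4 * w ^+ 2)^-1
        * umbrella_E p q P Q w m &
      whitney_a02 h x.1 = A `^ (1 / 2) * B `^ (3 / 2) * (4 * w ^+ 2)^-1].
Proof.
move=> s33 s32; have J1 := umbrella_jet_S1 s33 s32.
pose g33 y := cst (-1) y * f33 y.
have [sg33 _ Dg33] : germ_derive ((1, 0) : R * R) g33
    (fun y => cst (-1) y * pd1 f33 y + f33 y * cst 0 y).
  exact: germ_deriveM (germ_derive_cst _ _) (germ_derive_smooth _ s33).
have J2 := umbrella_jet_S1 sg33 (smooth_germ_flip s32).
have Dg := near_us Dg33.
apply: filterS3 J1 J2 Dg => x J1x J2x Dgx v0.
set y := (x.1.1, x.2) in J1x J2x Dgx *; set w := pd1 f33 y in J1x Dgx *.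
have Jh := J1x v0.
have x1E : (x.1.1, - x.1.2) = x.1 by case: x.1 v0 => u v /= ->; rewrite oppr0.
have Dw : pd1 g33 y = - w.
  have [_ E] := Dgx; apply: etrans E _.
  by rewrite /cst mulr0 addr0 mulN1r.
apply: (whitney_umbrella_jet Jh).
have f32E : f32 (x.1.1, - x.1.2, x.2) = f32 x by rewrite x1E; case: (x).
have := J2x v0; rewrite Dw (_ : 2 * _ = 2 * f32 x); last by congr (2 * _); exact: f32E.
rewrite x1E; congr umbrella_jet; apply/funext => z.
by rewrite /S1_deformation /g33 /cst /=; congr vec3; ring.
Qed.

End UmbrellasOfDeformation.

(** * Expansions at the singular point *)

Section CoefficientJets.
Variable R : realType.
Implicit Types f g : R -> R.

(** Forgets the coefficients, for a factor multiplied by something with zero 1-jet such as s, u^2 or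
    t^2. *)
Lemma jet_ex f a b : jet f a b -> exists c d, jet f c d.
Proof. by move=> jf; exists a, b. Qed.

(** The inverse is written as a real power so that its smoothness is an instance of [jet_powR]. *)
Lemma jetV f a b : 0 < a -> jet f a b -> jet (fun t => f t `^ (-1)) a^-1 (- b / a ^+ 2).
Proof.
move=> a0 jf; apply: (eq_jet (jet_powR (-1) a0 jf)).
  by rewrite powR_inv1 // ltW.
have -> : -1 - 1 = - 2%:R :> R by ring.
by rewrite powR_invn ?ltW // mulN1r !mulNr mulrC.
Qed.

Lemma jet_powR_stationary f (r a : R) : 0 < a -> jet f a 0 ->
  jet (fun t => f t `^ r) (a `^ r) 0.
Proof. by move=> a0 jf; apply: (eq_jet (jet_powR r a0 jf)); rewrite ?mulr0. Qed.

Lemma powR4_half (n : nat) : (4 : R) `^ (n%:R / 2) = 2 ^+ n.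
Proof.
have -> : (4 : R) = 2 `^ 2 by rewrite -[2 in RHS]/(2%:R) powR_mulrn //; ring.
by rewrite -powRrM mulrCA divff // mulr1 powR_mulrn.
Qed.

Lemma jet_axis_u g (k : R * R -> R) u s b : smooth_germ g -> smooth_germ k ->
  jet u 0 b -> jet s 0 0 -> jet (fun t => axis_u g k (u t, s t)) 0 (2 * b * g 0).
Proof.
move=> sg sk ju js.
have [g0 [g1 jg']] := jet_ex (jet_comp (smooth_germ_derive (1 : R) sg) ju).
have [k0 [k1 jk]] := jet_ex (jet_comp2 sk ju js).
have [l0 [l1 jk']] := jet_ex
  (jet_comp2 (smooth_germ_derive ((1, 0) : R * R) sk) ju js).
have := jetD (jetD (jetD (jetM (jetM (jet_cst 2) ju) (jet_comp sg ju))
  (jetM (jetX 2 ju) jg')) (jetM js jk)) (jetM (jetM ju js) jk').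
by move/eq_jet; apply; move: ('D_1 g 0) => d /=; ring.
Qed.

(** The slope 6 b g'(0) is 2 b g'(0) from 2 g(u) plus 4 b g'(0) from 4 u g'(u); for g = f31 it
    yields the coefficient 3 in [K]. *)
Lemma jet_axis_uu g (k : R * R -> R) u s b : smooth_germ g -> smooth_germ k ->
  jet u 0 b -> jet s 0 0 ->
  jet (fun t => axis_uu g k (u t, s t)) (2 * g 0) (6 * b * 'D_1 g 0).
Proof.
move=> sg sk ju js; have sg' := smooth_germ_derive (1 : R) sg.
have sk' := smooth_germ_derive ((1, 0) : R * R) sk.
have jg := jet_comp sg ju; have jg' := jet_comp sg' ju.
have [g0 [g1 jg'']] := jet_ex (jet_comp (smooth_germ_derive (1 : R) sg') ju).
have [k0 [k1 jk]] := jet_ex (jet_comp2 sk' ju js).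
have [l0 [l1 jk']] := jet_ex
  (jet_comp2 (smooth_germ_derive ((1, 0) : R * R) sk') ju js).
have := jetD (jetD (jetD (jetD (jetM (jet_cst 2) jg)
  (jetM (jetM (jet_cst 4) ju) jg')) (jetM (jetX 2 ju) jg''))
  (jetM (jetM (jet_cst 2) js) jk)) (jetM (jetM ju js) jk').
by move/eq_jet; apply; move: ('D_1 g 0) (b * 'D_1 ('D_1 g) 0) => d d' /=; ring.
Qed.

Section Umbrella.
Variables (p q P Q w m : R -> R) (p1 q1 P0 P1 f Q1 c w1 m1 : R).
Hypotheses (jp : jet p 0 p1) (jq : jet q 0 q1) (jP : jet P P0 P1).
Hypotheses (jQ : jet Q (2 * f) Q1) (jw : jet w (2 * c) w1) (jm : jet m 0 m1).
Hypothesis c0 : 0 < c.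

Let A t := umbrella_A (p t) (q t).
Let B t := umbrella_B (p t) (q t) (m t).
Let V t := (4 * w t ^+ 2) `^ (-1).
Let N1 := P0 * m1 - 2 * Q1.

Let jA : jet A 1 0.
Proof.
have := jetD (jetD (jet_cst 1) (jetX 2 jp)) (jetX 2 jq).
by move/eq_jet; apply=> /=; ring.
Qed.

Let jB : jet B 4 0.
Proof.
have := jetD (jetD (jet_cst 4) (jetX 2 jm))
  (jetX 2 (jetD (jetM jp jm) (jetN (jetM (jet_cst 2) jq)))).
by move/eq_jet; apply=> /=; ring.
Qed.

Let jV : jet V (16 * c ^+ 2)^-1 (- w1 / (16 * c ^+ 3)).
Proof.
have j4 := jetM (jet_cst 4) (jetX 2 jw).
have w0 : 0 < 4 * (2 * c) ^+ 2 by rewrite mulr_gt0 // exprn_gt0 // mulr_gt0.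
apply: (eq_jet (jetV w0 j4)); first by congr (_^-1); ring.
by rewrite /=; field; rewrite gt_eqF.
Qed.

Let jN : jet (fun t => umbrella_N (P t) (Q t) (m t)) (- 4 * f) N1.
Proof.
have := jetD (jetM jP jm) (jetN (jetM (jet_cst 2) jQ)).
by move/eq_jet; apply; rewrite /N1; ring.
Qed.

Let jtw : jet (fun t => t * w t) 0 (2 * c).
Proof. by apply: (eq_jet (jetM (@jet_id R) jw)); ring. Qed.

(** To first order D is N^2, as the other term carries (t w)^2. The value is 1/4 times 4^(1/2) times
    16 f^2 / (16 c^2). *)
Lemma jet_a20 :
  jet (fun t => 1 / 4 * A t `^ (- (3 / 2)) * B t `^ (1 / 2) * V t
        * umbrella_D (P t) (Q t) (t * w t) (m t))
    (f ^+ 2 / (2 * c ^+ 2)) (- (f * N1) / (4 * c ^+ 2) - w1 * f ^+ 2 / (2 * c ^+ 3)).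
Proof.
have jD := jetD (jetX 2 jN) (jetM (jetM (jet_cst 8) (jetX 2 jtw)) jP).
have := jetM (jetM (jetM (jetM (jet_cst (1 / 4))
  (jet_powR_stationary (- (3 / 2)) ltr01 jA))
  (jet_powR_stationary (1 / 2) (ltr0n _ 4) jB)) jV) jD.
move/eq_jet; apply; rewrite powR1 (powR4_half 1) /=; field; by rewrite gt_eqF.
Qed.

(** To first order E is -B N with B stationary at 4, so its value is 16 f and its slope -4 [N1]. *)
Lemma jet_a11 :
  jet (fun t => 1 / 2 * A t `^ (- (1 / 2)) * V t
        * umbrella_E (p t) (q t) (P t) (Q t) (t * w t) (m t))
    (f / (2 * c ^+ 2)) (- N1 / (8 * c ^+ 2) - w1 * f / (2 * c ^+ 3)).
Proof.
have jE := jetD (jetM (jetM (jet_cst (- 4)) (jetX 2 jtw)) (jetD (jetM jA jm)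
  (jetN (jetM jq (jetD (jetM (jet_cst 2) jp) (jetM jm jq)))))) (jetN (jetM jB jN)).
have := jetM (jetM (jetM (jet_cst (1 / 2))
  (jet_powR_stationary (- (1 / 2)) ltr01 jA)) jV) jE.
move/eq_jet; apply; rewrite powR1 /=; field; by rewrite gt_eqF.
Qed.

(** The value is 4^(3/2) / (16 c^2). The slope stays unspecified, since only the leading coefficient
    is expanded. *)
Lemma jet_a02 : exists b,
  jet (fun t => A t `^ (1 / 2) * B t `^ (3 / 2) * V t) (1 / (2 * c ^+ 2)) b.
Proof.
have J := jetM (jetM (jet_powR_stationary (1 / 2) ltr01 jA)
  (jet_powR_stationary (3 / 2) (ltr0n _ 4) jB)) jV.
eexists; apply: (eq_jet J) => //; rewrite powR1 (powR4_half 3).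
by field; rewrite gt_eqF.
Qed.

End Umbrella.
End CoefficientJets.

Section AlongCurve.
Variable R : realType.
Implicit Types u s : R -> R.

Lemma jet_cvg u b : jet u 0 b -> u t @[t --> (0 : R)] --> (0 : R).
Proof.
move=> [su u0 _]; rewrite -[X in _ --> X]u0.
exact/differentiable_continuous/differentiable_smooth_germ.
Qed.

Lemma near_curve2 (P : R * R -> Prop) u s b c : jet u 0 b -> jet s 0 c ->
  (\forall y \near (0 : R * R), P y) -> \forall t \near (0 : R), P (u t, s t).
Proof. by move=> /jet_cvg ju /jet_cvg js nP; exact: (cvg_pair ju js nP). Qed.

Lemma near_curve3 (P : R * R * R -> Prop) u v s b c d :
  jet u 0 b -> jet v 0 c -> jet s 0 d ->
  (\forall y \near (0 : R * R * R), P y) -> \forall t \near (0 : R), P (u t, v t, s t).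
Proof.
move=> /jet_cvg ju /jet_cvg jv /jet_cvg js nP.
exact: (cvg_pair (cvg_pair ju jv) js nP).
Qed.

Lemma near_pd1_f33 (f33 : R * R -> R) (c1 c2 c3 : R -> R) (c4 : R * R -> R) :
  smooth_germ c1 -> smooth_germ c2 -> smooth_germ c3 -> smooth_germ c4 ->
  (\forall x \near (0 : R * R), f33 x = x.2 + x.1 * x.2 * c1 x.2 + x.1 ^+ 2 * c2 x.2
     + x.1 ^+ 3 * c3 x.2 + x.1 ^+ 4 * c4 x) ->
  \forall x \near (0 : R * R), pd1 f33 x = x.2 * c1 x.2 + 2 * x.1 * c2 x.2
     + 3 * x.1 ^+ 2 * c3 x.2 + 4 * x.1 ^+ 3 * c4 x + x.1 ^+ 4 * pd1 c4 x.
Proof.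
move=> s1 s2 s3 s4 /(near_derive_near ((1, 0) : R * R)) E.
have U := germ_derive_coord1 R; have S := germ_derive_coord2 R.
have C (c : R -> R) : smooth_germ c ->
    germ_derive ((1, 0) : R * R) (fun x => c x.2) (cst 0).
  move=> sc; apply: (@germ_derive_pullback _ _ _ snd ((1, 0) : R * R) c (cst 0)) => [//|x|].
    exact: differentiable_snd.
  exact: germ_derive_zero.
have C4 := germ_derive_smooth ((1, 0) : R * R) s4.
have U2 := germ_deriveM U U; have U3 := germ_deriveM U U2; have U4 := germ_deriveM U U3.
have [_ _ D] := germ_deriveD (germ_deriveD (germ_deriveD (germ_deriveD S
  (germ_deriveM (germ_deriveM U S) (C _ s1))) (germ_deriveM U2 (C _ s2)))
  (germ_deriveM U3 (C _ s3))) (germ_deriveM U4 C4).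
apply: filterS2 E D => x E [_ D]; apply: etrans E _.
under eq_fun do rewrite !exprS expr0 mulr1.
apply: etrans D _; rewrite /pd1 /cst; move: ('D_((1, 0) : R * R) c4 x) => d.
by move: (c4 x) (c1 x.2) (c2 x.2) (c3 x.2) => *; ring.
Qed.

Lemma near_whitney_S1 (f21 f31 : R -> R) (f24 f33 f34 : R * R -> R)
    (f32 : R * R * R -> R) u s b c :
  smooth_germ f21 -> smooth_germ f31 -> smooth_germ f24 -> smooth_germ f34 ->
  smooth_germ f33 -> smooth_germ f32 -> jet u 0 b -> jet s 0 c ->
  \forall t \near (0 : R),
  let h (z : R * R) := S1_deformation f21 f31 f24 f33 f34 f32 (z.1, z.2, s t) in
  let p := axis_u f21 f24 (u t, s t) in let q := axis_u f31 f34 (u t, s t) in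
  let P := axis_uu f21 f24 (u t, s t) in let Q := axis_uu f31 f34 (u t, s t) in
  let w := pd1 f33 (u t, s t) in let m := 2 * f32 (u t, 0, s t) in
  let A := umbrella_A p q in let B := umbrella_B p q m in
  [/\ whitney_a20 h (u t, 0) = 1 / 4 * A `^ (- (3 / 2)) * B `^ (1 / 2)
        * (4 * w ^+ 2)^-1 * umbrella_D P Q w m,
      whitney_a11 h (u t, 0) = 1 / 2 * A `^ (- (1 / 2)) * (4 * w ^+ 2)^-1
        * umbrella_E p q P Q w m &
      whitney_a02 h (u t, 0) = A `^ (1 / 2) * B `^ (3 / 2) * (4 * w ^+ 2)^-1].
Proof.
move=> s21 s31 s24 s34 s33 s32 ju js.
have := near_curve3 ju (jet_cst 0) js (whitney_S1 s21 s31 s24 s34 s33 s32).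
by apply: filterS => t /(_ erefl).
Qed.

End AlongCurve.

Section SingularPoint.
Variable R : realType.
Variables (f33 : R * R -> R) (c1 c2 c3 : R -> R) (c4 : R * R -> R) (us : R -> R) (c20 : R).
Hypotheses (s1 : smooth_germ c1) (s2 : smooth_germ c2).
Hypotheses (s3 : smooth_germ c3) (s4 : smooth_germ c4).
Hypothesis f33E : \forall x \near (0 : R * R), f33 x = x.2 + x.1 * x.2 * c1 x.2
  + x.1 ^+ 2 * c2 x.2 + x.1 ^+ 3 * c3 x.2 + x.1 ^+ 4 * c4 x.
Hypotheses (c20_gt0 : 0 < c20) (c2E : c2 0 = c20 ^+ 2).
Hypothesis jus : jet us 0 (1 / c20).
Hypothesis us_sing : \forall t \near (0 : R), f33 (us t, - t ^+ 2) = 0.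

Lemma jet_opp_sqr : jet (fun t : R => - t ^+ 2) 0 0.
Proof. by apply: (eq_jet (jetN (jetX 2 (@jet_id R)))) => /=; ring. Qed.

(** With us t = t v(t) and v(0) = 1/c20, every term of the u-derivative of f33 on the curve is
    divisible by t. The quotient has value 2 c20 and slope -c1(0) + 2 v'(0) c20^2 + 3 c3(0) / c20^2,
    to be simplified by the equation of the singular point. *)
Lemma pd1_f33_singular_point : exists w, jet w (2 * c20) (2 * c3 0 / c20 ^+ 2) /\
  \forall t \near (0 : R), pd1 f33 (us t, - t ^+ 2) = t * w t.
Proof.
have js := jet_opp_sqr; have ccE : c20 != 0 by rewrite gt_eqF.
have jc (c : R -> R) : smooth_germ c -> jet (fun t => c (- t ^+ 2)) (c 0) 0.
  by move=> sc; apply: (eq_jet (jet_comp sc js)); rewrite ?mul0r.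
have [ds us0 [_ dus]] := jus.
have [v [sv v0 usE]] := hadamard ds.
have {}usE t : us t = t * v t by rewrite usE us0 add0r.
have jv := jet_smooth sv; rewrite v0 dus in jv; move: ('D_1 v 0) jv => v1 jv.
have [e0 [e1 j4]] := jet_ex (jet_comp2 s4 jus js).
have [k0 [k1 j4']] := jet_ex (jet_comp2 (smooth_germ_derive ((1, 0) : R * R) s4) jus js).
have jt := @jet_id R; have j1 := jc _ s1; have j2 := jc _ s2; have j3 := jc _ s3.
rewrite c2E in j2; move: (c1 0) (c3 0) j1 j3 => a1 a3 j1 j3.
(* [f33 (us t, -t^2) = t^2 Z t] *)
pose Z t := -1 + (- (t * v t * c1 (- t ^+ 2))) + v t ^+ 2 * c2 (- t ^+ 2)
  + t * (v t ^+ 3 * c3 (- t ^+ 2)) + t ^+ 2 * (v t ^+ 4 * c4 (us t, - t ^+ 2)).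
have jZ : jet Z 0 (- (a1 / c20) + 2 * v1 * c20 + a3 / c20 ^+ 3).
  have := jetD (jetD (jetD (jetD (jet_cst (-1)) (jetN (jetM (jetM jt jv) j1)))
    (jetM (jetX 2 jv) j2)) (jetM jt (jetM (jetX 3 jv) j3)))
    (jetM (jetX 2 jt) (jetM (jetX 4 jv) j4)).
  by move/eq_jet; apply=> /=; field.
(* For t nonzero t^2 is cancelled; at t = 0 the value is -1 + c20^2 / c20^2. *)
have Z0 : \forall t \near (0 : R), Z t = 0.
  apply: filterS2 us_sing (near_curve2 jus js f33E) => t -> /= E.
  have [->|t0] := eqVneq t 0; first by have [_ ->] := jZ.
  apply: (mulfI (expf_neq0 2 t0)); rewrite mulr0 [RHS]E /Z usE.
  by move: (c4 _) (c1 _) (c2 _) (c3 _) => *; ring.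
have rel : - (a1 / c20) + 2 * v1 * c20 + a3 / c20 ^+ 3 = 0.
  have [_ _ [_ <-]] := jZ.
  rewrite (@near_eq_derive _ _ _ Z (cst 0)) ?derive_cst //.
exists (fun t => - (t * c1 (- t ^+ 2)) + 2 * v t * c2 (- t ^+ 2)
  + 3 * (t * (v t ^+ 2 * c3 (- t ^+ 2)))
  + t ^+ 2 * (4 * (v t ^+ 3 * c4 (us t, - t ^+ 2))
     + t * (v t ^+ 4 * pd1 c4 (us t, - t ^+ 2)))); split.
  have := jetD (jetD (jetD (jetN (jetM jt j1)) (jetM (jetM (jet_cst 2) jv) j2))
    (jetM (jet_cst 3) (jetM jt (jetM (jetX 2 jv) j3))))
    (jetM (jetX 2 jt) (jetD (jetM (jet_cst 4) (jetM (jetX 3 jv) j4))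
      (jetM jt (jetM (jetX 4 jv) j4')))).
  move/eq_jet; apply=> /=; first by field.
  (* Solving for c1(0) also cancels v'(0), leaving (3 - 1) c3(0) / c20^2. *)
  have -> : a1 = 2 * v1 * c20 ^+ 2 + a3 / c20 ^+ 2.
    by apply/eqP; rewrite -subr_eq0 -(mulr0 (- c20)) -rel; apply/eqP; field.
  by field.
apply: filterS (near_curve2 jus js (near_pd1_f33 s1 s2 s3 s4 f33E)) => t -> /=.
rewrite usE; move: (pd1 c4 _) (c4 _) => *.
by move: (c1 _) (c2 _) (c3 _) => *; ring.
Qed.

End SingularPoint.

Theorem theorem3p4 (R : realType)
  (f21 f31 : R -> R) (f24 f33 f34 : R * R -> R) (f32 : R * R * R -> R)
  (hf : S1_normal_form f21 f31 f24 f33 f34 f32)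
  (c1 c2 c3 : R -> R) (c4 : R * R -> R)
  (hc1 : smooth_germ c1) (hc2 : smooth_germ c2) (hc3 : smooth_germ c3)
  (hc4 : smooth_germ c4)
  (hf33 : \forall x \near ((0, 0) : R * R), let: (u, s) := x in
     f33 (u, s) = s + u * s * c1 s + u ^+ 2 * c2 s + u ^+ 3 * c3 s
                  + u ^+ 4 * c4 (u, s))
  (d1 d2 d3 : R * R * R -> R)
  (hd1 : smooth_germ d1) (hd2 : smooth_germ d2) (hd3 : smooth_germ d3)
  (hf32 : \forall x \near ((0, 0, 0) : R * R * R), let: (u, v, s) := x in
     f32 (u, v, s) = u * d1 (u, v, s) + v * d2 (u, v, s) + s * d3 (u, v, s))
  (c20 : R) (c20_gt0 : 0 < c20) (hc20 : c2 0 = c20 ^+ 2)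
  (us : R -> R) (us_smooth : smooth_germ us) (us0 : us 0 = 0)
  (dus0 : (us^`())%classic 0 = 1 / c20)
  (us_sing : \forall t \near (0 : R), f33 (us t, - t ^+ 2) = 0) :
  let h (t : R) (x : R * R) : 'rV[R]_3 :=
    S1_deformation f21 f31 f24 f33 f34 f32 (x.1, x.2, - t ^+ 2) in
  let a20 (t : R) := whitney_a20 (h t) (us t, 0) in
  let a11 (t : R) := whitney_a11 (h t) (us t, 0) in
  let a02 (t : R) := whitney_a02 (h t) (us t, 0) in
  let K := 3 * (f31^`())%classic 0 - d1 (0, 0, 0) * f21 0 in
  [/\ exists2 g : R -> R, Osmooth 2 g &
        \forall t \near (0 : R)^', a20 t = 1 / t ^+ 2 *
          (f31 0 ^+ 2 / (2 * c20 ^+ 2)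
           - f31 0 * (f31 0 * c3 0 - c20 ^+ 2 * K) / c20 ^+ 5 * t + g t),
      exists2 g : R -> R, Osmooth 2 g &
        \forall t \near (0 : R)^', a11 t = 1 / t ^+ 2 *
          (f31 0 / (2 * c20 ^+ 2)
           - (2 * c3 0 * f31 0 - c20 ^+ 2 * K) / (2 * c20 ^+ 5) * t + g t) &
      exists2 g : R -> R, Osmooth 1 g &
        \forall t \near (0 : R)^', a02 t = 1 / t ^+ 2 *
          (1 / (2 * c20 ^+ 2) + g t)].
Proof.
move=> h a20 a11 a02 K.
have [s21 s24 s31 s32 s33 s34 _ _ _ _ _] := hf.
have js := @jet_opp_sqr R.
have jus : jet us 0 (1 / c20).
  by rewrite -us0 -dus0 derive1E; exact: jet_smooth.
have f33E : \forall x \near (0 : R * R), f33 x = x.2 + x.1 * x.2 * c1 x.2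
    + x.1 ^+ 2 * c2 x.2 + x.1 ^+ 3 * c3 x.2 + x.1 ^+ 4 * c4 x.
  by apply: filterS hf33 => -[].
have [w [jw wE]] := pd1_f33_singular_point hc1 hc2 hc3 hc4 f33E c20_gt0 hc20 jus us_sing.
(* On the axis v = 0 the d2 term disappears, and s = -t^2 makes the d3 term of second order, so
   d1(0, 0, 0) alone determines the slope of m. *)
pose m t := 2 * (us t * d1 (us t, 0, - t ^+ 2) + - t ^+ 2 * d3 (us t, 0, - t ^+ 2)).
have mE : \forall t \near (0 : R), 2 * f32 (us t, 0, - t ^+ 2) = m t.
  apply: filterS (near_curve3 jus (jet_cst 0) js hf32) => t /= ->.
  by rewrite mul0r addr0.
have jm : jet m 0 (2 / c20 * d1 (0, 0, 0)).
  have [x1 jd1] : exists b, jet (fun t => d1 (us t, 0, - t ^+ 2)) (d1 (0, 0, 0)) b.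
    by eexists; exact: jet_comp3 hd1 jus (jet_cst 0) js.
  have [y3 [x3 jd3]] := jet_ex (jet_comp3 hd3 jus (jet_cst 0) js).
  have := jetM (jet_cst 2) (jetD (jetM jus jd1) (jetM js jd3)).
  by move/eq_jet; apply; ring.
have jp := jet_axis_u s21 s24 jus js; have jq := jet_axis_u s31 s34 jus js.
have jP := jet_axis_uu s21 s24 jus js; have jQ := jet_axis_uu s31 s34 jus js.
have J20 := jet_a20 jp jq jP jQ jw jm c20_gt0.
have J11 := jet_a11 jp jq jP jQ jw jm c20_gt0.
have [b J02] := jet_a02 jp jq jw jm c20_gt0.
have W := near_whitney_S1 s21 s31 s24 s34 s33 s32 jus js.
(* The factor 1/t^2 of the expansions. Where [w t = 0] both sides are 0 by convention, so the
   identity can be used at every nonzero [t]. *)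
have inv_sqr (t : R) : t != 0 ->
    (4 * (t * w t) ^+ 2)^-1 = (t ^+ 2)^-1 * (4 * w t ^+ 2) `^ (-1).
  move=> t0; have w0 : 0 <= 4 * w t ^+ 2 by rewrite mulr_ge0 // sqr_ge0.
  by rewrite powR_inv1 // exprMn mulrCA invfM.
have near0 (P : R -> Prop) :
    (\forall t \near (0 : R), t != 0 -> P t) -> \forall t \near (0 : R)^', P t.
  by move=> nP; rewrite /dnbhs near_withinE.
split.
(* The remainder is the smooth extension of t^2 a20 minus its 1-jet. The final [field] matches the
   slopes, using that P0 m1 - 2 Q1 becomes -4 K / c20 and that w has slope 2 c3(0) / c20^2. *)
- eexists; first exact: jet_Osmooth2 J20.
  apply: near0; apply: filterS3 wE mE W => t wt mt [E _ _] t0.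
  rewrite [LHS]E wt mt inv_sqr //.
  move: (umbrella_A _ _ `^ _) (umbrella_B _ _ _ `^ _) (_ `^ (-1)) => A B V.
  move: (umbrella_D _ _ _ _) => D; rewrite /K derive1E; move: ('D_1 f31 0) => df.
  by field; rewrite t0 gt_eqF.
- eexists; first exact: jet_Osmooth2 J11.
  apply: near0; apply: filterS3 wE mE W => t wt mt [_ E _] t0.
  rewrite [LHS]E wt mt inv_sqr //.
  move: (umbrella_A _ _ `^ _) (_ `^ (-1)) => A V.
  move: (umbrella_E _ _ _ _ _ _) => E'; rewrite /K derive1E; move: ('D_1 f31 0) => df.
  by field; rewrite t0 gt_eqF.
- eexists; first exact: jet_Osmooth1 J02.
  apply: near0; apply: filterS3 wE mE W => t wt mt [_ _ E] t0.
  rewrite [LHS]E wt mt inv_sqr //.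
  move: (umbrella_A _ _ `^ _) (umbrella_B _ _ _ `^ _) (_ `^ (-1)) => A B V.
  by field; rewrite t0 gt_eqF.
Qed.
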